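(* Let $\mathsf{KH}$ be the category of compact Hausdorff spaces and continuous maps, and let $\Delta$ be the category of $\delta$-algebras and $\delta$-homomorphisms. For a compact Hausdorff space $X$, regard $\hom_{\mathsf{KH}}(X,[0,1])=\mathrm{C}(X)$ (continuous functions $X\to[0,1]$) as a $\delta$-algebra with pointwise MV-operations and $\delta(g_1,g_2,\ldots):=\sum_{i=1}^\infty g_i/2^i$ (for $X=\emptyset$, $\mathrm{C}(X)$ is the trivial one-element $\delta$-algebra); for a $\delta$-algebra $A$, regard $\hom_{\Delta}(A,[0,1])$ as a topological space with the initial topology with respect to the evaluation maps $h\mapsto h(a)$, $a\in A$, where $[0,1]$ carries its Euclidean topology. Then the contravariant functors $\hom_{\mathsf{KH}}(-,[0,1])\colon \mathsf{KH}\to\Delta$ and $\hom_{\Delta}(-,[0,1])\colon\Delta\to\mathsf{KH}$ (acting on morphisms by precomposition) form a dual equivalence of categories.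
   Context: An MV-algebra is a structure $(A,\oplus,\neg,0)$ such that $(A,\oplus,0)$ is a commutative monoid, $\neg\neg x=x$, $x\oplus\neg 0=\neg 0$, and $\neg(\neg x\oplus y)\oplus y=\neg(\neg y\oplus x)\oplus x$. Write $1:=\neg 0$, $x\odot y:=\neg(\neg x\oplus\neg y)$, $x\ominus y:=x\odot\neg y$, $d(x,y):=(x\ominus y)\oplus(y\ominus x)$. The relation $x\le y$ iff $x\ominus y=0$ is a lattice order with $x\vee y=\neg(\neg x\oplus y)\oplus y$, $x\wedge y=\neg(\neg x\vee\neg y)$. The interval $[0,1]$ is an MV-algebra with $x\oplus y=\min\{x+y,1\}$, $\neg x=1-x$, and is a $\delta$-algebra with $\delta(u_1,u_2,\ldots)=\sum_i u_i/2^i$. A $\delta$-algebra is a structure $(A,\delta,\oplus,\neg,0)$ where $(A,\oplus,\neg,0)$ is an MV-algebra and $\delta$ is an operation of countably infinite arity such that, writing $\vec x=(x_1,x_2,\ldots)$, $\vec 0=(0,0,\ldots)$ and $f_{1/2}(x):=\delta(x,\vec 0)$, the following hold for all arguments: (A1) $d(\delta(\vec x),\delta(x_1,\vec 0))=\delta(0,x_2,x_3,\ldots)$; (A2) $f_{1/2}(\delta(\vec x))=\delta(f_{1/2}(x_1),f_{1/2}(x_2),\ldots)$; (A3) $\delta(x,x,\ldots)=x$; (A4) $\delta(0,\vec x)=f_{1/2}(\delta(\vec x))$; (A5) $\delta(x_1\oplus y_1,x_2\oplus y_2,\ldots)\ge\delta(x_1,x_2,\ldots)$; (A6) $f_{1/2}(x\ominus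 y)=f_{1/2}(x)\ominus f_{1/2}(y)$. A $\delta$-homomorphism is an MV-algebra homomorphism (preserving $\oplus,\neg,0$) that also preserves $\delta$. *)

(* Defs.v *)
From HB Require Import structures.
From mathcomp Require Import all_boot all_order all_algebra.
From mathcomp Require Import all_classical all_reals all_analysis.
From mathcomp Require Import lra.
Import Order.TTheory GRing.Theory Num.Theory.
Import numFieldNormedType.Exports.

Set Implicit Arguments.
Unset Strict Implicit.
Unset Printing Implicit Defensive.

Local Open Scope classical_set_scope.
Local Open Scope ring_scope.

Record category := Category {
  obj :> Type;
  hom : obj -> obj -> Type;
  idm : forall X, hom X X;
  comp : forall X Y Z, hom Y Z -> hom X Y -> hom X Z;
  compA : forall X Y Z W (h : hom Z W) (g : hom Y Z) (f : hom X Y),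
    comp h (comp g f) = comp (comp h g) f;
  comp1m : forall X Y (f : hom X Y), comp (idm Y) f = f;
  compm1 : forall X Y (f : hom X Y), comp f (idm X) = f }.

Arguments hom {c} X Y.
Arguments idm {c} X.
Arguments comp {c X Y Z} g f.
Arguments compA {c X Y Z W} h g f.
Arguments comp1m {c X Y} f.
Arguments compm1 {c X Y} f.

Definition isomorphism (C : category) (X Y : C) (f : hom X Y) : Prop :=
  exists g : hom Y X, comp g f = idm X /\ comp f g = idm Y.

Record functor (C D : category) := Functor {
  fobj :> C -> D;
  fmor : forall X Y : C, hom X Y -> hom (fobj X) (fobj Y);
  fmor_id : forall X : C, fmor (idm X) = idm (fobj X);
  fmor_comp : forall (X Y Z : C) (g : hom Y Z) (f : hom X Y),
    fmor (comp g f) = comp (fmor g) (fmor f) }.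

Arguments fmor {C D} F {X Y} f : rename.

Record contravariant_functor (C D : category) := ContravariantFunctor {
  cobj :> C -> D;
  cmor : forall X Y : C, hom X Y -> hom (cobj Y) (cobj X);
  cmor_id : forall X : C, cmor (idm X) = idm (cobj X);
  cmor_comp : forall (X Y Z : C) (g : hom Y Z) (f : hom X Y),
    cmor (comp g f) = comp (cmor f) (cmor g) }.

Arguments cmor {C D} F {X Y} f : rename.

Definition functor_id (C : category) : functor C C :=
  @Functor C C id (fun _ _ f => f) (fun _ => erefl) (fun _ _ _ _ _ => erefl).

Section contravariant_comp.
Context (C D E : category).
Context (G : contravariant_functor D E) (F : contravariant_functor C D).

Let GF_mor (X Y : C) (f : hom X Y) : hom (G (F X)) (G (F Y)) :=
  cmor G (cmor F f).

Lemma contravariant_comp_id (X : C) : GF_mor (idm X) = idm (G (F X)).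
Proof. by rewrite /GF_mor !cmor_id. Qed.

Lemma contravariant_comp_comp (X Y Z : C) (g : hom Y Z) (f : hom X Y) :
  GF_mor (comp g f) = comp (GF_mor g) (GF_mor f).
Proof. by rewrite /GF_mor !cmor_comp. Qed.

Definition contravariant_comp : functor C E :=
  @Functor C E (fun X => G (F X)) GF_mor
    contravariant_comp_id contravariant_comp_comp.

End contravariant_comp.

Definition naturally_isomorphic (C D : category) (F G : functor C D) : Prop :=
  exists eta : forall X : C, hom (F X) (G X),
    (forall (X Y : C) (f : hom X Y),
       comp (eta Y) (fmor F f) = comp (fmor G f) (eta X)) /\
    (forall X : C, isomorphism (eta X)).

Definition dual_equivalence (C D : category)
    (F : contravariant_functor C D) (G : contravariant_functor D C) : Prop :=
  naturally_isomorphic (functor_id C) (contravariant_comp G F) /\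
  naturally_isomorphic (functor_id D) (contravariant_comp F G).

HB.mixin Record isMVAlgebra (A : Type) := {
  mvzero : A;
  mvplus : A -> A -> A;
  mvneg : A -> A;
  mvplusA : associative mvplus;
  mvplusC : commutative mvplus;
  mvplusx0 : right_id mvzero mvplus;
  mvnegK : involutive mvneg;
  mvplusxN0 : forall x, mvplus x (mvneg mvzero) = mvneg mvzero;
  mvplus_lukasiewicz : forall x y,
    mvplus (mvneg (mvplus (mvneg x) y)) y =
    mvplus (mvneg (mvplus (mvneg y) x)) x }.

#[short(type = "mvAlgebraType")]
HB.structure Definition MVAlgebra := { A of isMVAlgebra A }.

Section mv_operations.
Context {A : mvAlgebraType}.
Implicit Types x y : A.

Definition mvone : A := mvneg mvzero.
Definition mvtimes x y : A := mvneg (mvplus (mvneg x) (mvneg y)).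
Definition mvminus x y : A := mvtimes x (mvneg y).
Definition mvdist x y : A := mvplus (mvminus x y) (mvminus y x).
Definition mvle x y : Prop := mvminus x y = mvzero.

End mv_operations.

(* The arguments of delta, usually numbered from 1, are numbered from 0:
   the n-th term of a sequence is the argument of index n.+1. *)
Definition scons (T : Type) (x : T) (u : nat -> T) : nat -> T :=
  fun n => if n is m.+1 then u m else x.

Definition stail (T : Type) (u : nat -> T) : nat -> T := fun n => u n.+1.

Definition half_of (A : mvAlgebraType) (d : (nat -> A) -> A) (x : A) : A :=
  d (scons x (fun=> mvzero)).

HB.mixin Record MVAlgebra_isDeltaAlgebra A of MVAlgebra A := {
  delta : (nat -> A) -> A;
  delta_dist : forall x : nat -> A,
    mvdist (delta x) (delta (scons (x 0%N) (fun=> mvzero))) =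
    delta (scons mvzero (stail x));
  half_delta : forall x : nat -> A,
    half_of delta (delta x) = delta (fun n => half_of delta (x n));
  delta_cst : forall x : A, delta (fun=> x) = x;
  delta_scons0 : forall x : nat -> A,
    delta (scons mvzero x) = half_of delta (delta x);
  delta_mono : forall x y : nat -> A,
    mvle (delta x) (delta (fun n => mvplus (x n) (y n)));
  half_minus : forall x y : A,
    half_of delta (mvminus x y) =
    mvminus (half_of delta x) (half_of delta y) }.

#[short(type = "deltaAlgebraType")]
HB.structure Definition DeltaAlgebra :=
  { A of MVAlgebra A & MVAlgebra_isDeltaAlgebra A }.

Record deltaHom (A B : deltaAlgebraType) := DeltaHom {
  delta_fun :> A -> B;
  delta_fun0 : delta_fun mvzero = mvzero;
  delta_funD : {morph delta_fun : x y / mvplus x y};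
  delta_funN : {morph delta_fun : x / mvneg x};
  delta_fun_delta : forall x : nat -> A,
    delta_fun (delta x) = delta (fun n => delta_fun (x n)) }.

Lemma deltaHomP (A B : deltaAlgebraType) (f g : deltaHom A B) :
  f =1 g -> f = g.
Proof.
case: f g => [f f0 fD fN fd] [g g0 gD gN gd] /= /funext fg.
by subst g; congr DeltaHom; exact: Prop_irrelevance.
Qed.

Section delta_category.
Implicit Types A B C D : deltaAlgebraType.

Definition deltaHom_id A : deltaHom A A :=
  @DeltaHom A A id erefl (fun _ _ => erefl) (fun _ => erefl) (fun _ => erefl).

Section comp.
Context {A B C : deltaAlgebraType} (g : deltaHom B C) (f : deltaHom A B).

Lemma deltaHom_comp0 : (g \o f) mvzero = mvzero.
Proof. by rewrite /= !delta_fun0. Qed.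

Lemma deltaHom_compD : {morph g \o f : x y / mvplus x y}.
Proof. by move=> x y /=; rewrite !delta_funD. Qed.

Lemma deltaHom_compN : {morph g \o f : x / mvneg x}.
Proof. by move=> x /=; rewrite !delta_funN. Qed.

Lemma deltaHom_comp_delta (x : nat -> A) :
  (g \o f) (delta x) = delta (fun n => (g \o f) (x n)).
Proof. by rewrite /= !delta_fun_delta. Qed.

Definition deltaHom_comp : deltaHom A C :=
  DeltaHom deltaHom_comp0 deltaHom_compD deltaHom_compN deltaHom_comp_delta.

End comp.

Lemma deltaHom_compA A B C D
    (h : deltaHom C D) (g : deltaHom B C) (f : deltaHom A B) :
  deltaHom_comp h (deltaHom_comp g f) = deltaHom_comp (deltaHom_comp h g) f.
Proof. exact: deltaHomP. Qed.

Lemma deltaHom_comp1m A B (f : deltaHom A B) :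
  deltaHom_comp (deltaHom_id B) f = f.
Proof. exact: deltaHomP. Qed.

Lemma deltaHom_compm1 A B (f : deltaHom A B) :
  deltaHom_comp f (deltaHom_id A) = f.
Proof. exact: deltaHomP. Qed.

End delta_category.

Definition Delta : category :=
  @Category deltaAlgebraType deltaHom deltaHom_id (@deltaHom_comp)
    deltaHom_compA deltaHom_comp1m deltaHom_compm1.

Record compactHausdorff := CompactHausdorff {
  ch_space :> topologicalType;
  ch_compact : compact [set: ch_space];
  ch_hausdorff : hausdorff_space ch_space }.

Section compactHausdorff_category.
Implicit Types X Y Z W : compactHausdorff.

Definition ch_hom X Y := continuousType X Y.

Definition ch_id X : ch_hom X X := idfun.

Definition ch_comp X Y Z (g : ch_hom Y Z) (f : ch_hom X Y) : ch_hom X Z :=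
  g \o f.

Lemma ch_compA X Y Z W (h : ch_hom Z W) (g : ch_hom Y Z) (f : ch_hom X Y) :
  ch_comp h (ch_comp g f) = ch_comp (ch_comp h g) f.
Proof. exact/continuousEP. Qed.

Lemma ch_comp1m X Y (f : ch_hom X Y) : ch_comp (ch_id Y) f = f.
Proof. exact/continuousEP. Qed.

Lemma ch_compm1 X Y (f : ch_hom X Y) : ch_comp f (ch_id X) = f.
Proof. exact/continuousEP. Qed.

End compactHausdorff_category.

Definition KH : category :=
  @Category compactHausdorff ch_hom ch_id ch_comp ch_compA ch_comp1m ch_compm1.

Lemma cvg_initial (S : choiceType) (T : topologicalType) (f : S -> T)
    (F : set_system S) (s : S) : Filter F ->
  F --> (s : initial_topology f) <-> f @ F --> f s.
Proof.
move=> FF; split=> [Fs|Fs].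
  by apply: cvg_comp Fs _; exact: initial_continuous.
move=> A [_ [[B oB <-] /= Bfs BA]].
have FB : (f @ F) B by apply: Fs; exact: open_nbhs_nbhs.
exact: (filterS BA FB).
Qed.

(* It carries the subspace topology that the library puts on [set_type]. *)
Definition unit_interval (R : realType) : Type := set_type `[0 : R, 1].

HB.instance Definition _ (R : realType) :=
  Topological.copy (unit_interval R) (set_type `[0 : R, 1]).

Section unit_interval.
Context {R : realType}.
Local Notation I := (unit_interval R).

Definition ui_val (x : I) : R := set_val x.
Arguments ui_val : simpl never.

Lemma ui_ge0 (x : I) : 0 <= ui_val x.
Proof. by have /set_mem /= := valP x; rewrite in_itv /= => /andP[]. Qed.

Lemma ui_le1 (x : I) : ui_val x <= 1.
Proof. by have /set_mem /= := valP x; rewrite in_itv /= => /andP[]. Qed.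

Lemma ui_valP (x y : I) : ui_val x = ui_val y -> x = y.
Proof. exact: val_inj. Qed.

Lemma ui_subproof (r : R) : 0 <= r <= 1 -> r \in (`[0, 1]%classic : set R).
Proof. by move=> r01; apply/mem_set; rewrite /= in_itv. Qed.

Definition ui_mk (r : R) (r01 : 0 <= r <= 1) : I := exist _ r (ui_subproof r01).

Lemma ui_val_cvg (F : set_system I) (s : I) : Filter F ->
  F --> s <-> ui_val x @[x --> F] --> ui_val s.
Proof. exact: (@cvg_initial I R set_val). Qed.

Lemma ui_hausdorff : hausdorff_space I.
Proof.
move=> x y xy; apply: ui_valP; apply: (@norm_hausdorff R R).
move=> A B Ax By.
have c : continuous ui_val by exact: (@initial_continuous I R set_val).
have [z [Az Bz]] := xy _ _ (c x _ Ax) (c y _ By).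
by exists (ui_val z).
Qed.

Lemma ui_compact : compact [set: I].
Proof.
rewrite compact_ultra => F FU _.
have F01 : (ui_val @ F) `[0, 1]%classic.
  apply: (@filterS _ F _ setT) filterT => x _.
  by apply/andP; split; [exact: ui_ge0|exact: ui_le1].
have [p [p01 Fp]] := segment_compact _ F01.
have {}p01 : 0 <= p <= 1 by move: p01; rewrite /= in_itv.
exists (ui_mk p01); split=> //=; apply/ui_val_cvg => A /= pA.
move: pA; rewrite nbhsE => -[B oB BA].
have [|nFB] := in_ultra_setVsetC (ui_val @^-1` B) FU.
  by apply: filterS => x; exact: BA.
have [r [nBr Br]] := Fp (~` B) B nFB (open_nbhs_nbhs oB).
by [].
Qed.

Lemma ui_zero_subproof : 0 <= (0 : R) <= 1. Proof. by rewrite lexx ler01. Qed.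

Lemma ui_plus_subproof (x y : I) : 0 <= Num.min (ui_val x + ui_val y) 1 <= 1.
Proof.
rewrite le_min ler01 andbT ge_min lexx orbT andbT.
by rewrite addr_ge0 ?ui_ge0.
Qed.

Lemma ui_neg_subproof (x : I) : 0 <= 1 - ui_val x <= 1.
Proof. by have := ui_ge0 x; have := ui_le1 x; lra. Qed.

Definition ui_zero : I := ui_mk ui_zero_subproof.
Definition ui_plus (x y : I) : I := ui_mk (ui_plus_subproof x y).
Definition ui_neg (x : I) : I := ui_mk (ui_neg_subproof x).

Let plusE (x y : I) : ui_val (ui_plus x y) = Num.min (ui_val x + ui_val y) 1.
Proof. by []. Qed.

Let negE (x : I) : ui_val (ui_neg x) = 1 - ui_val x.
Proof. by []. Qed.

Let zeroE : ui_val ui_zero = 0. Proof. by []. Qed.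

Let valE := (plusE, negE, zeroE).

Ltac ui_solve :=
  apply: ui_valP; rewrite !valE;
  repeat match goal with x : unit_interval R |- _ =>
    have := ui_ge0 x; have := ui_le1 x; move: (ui_val x); clear x; move=> ? ? ? end;
  repeat (match goal with |- context [Num.min ?a ?b] =>
    lazymatch a with context [Num.min _ _] => fail | _ =>
    lazymatch b with context [Num.min _ _] => fail | _ =>
    case: (leP a b) => ? end end end); lra.

Lemma ui_plusA : associative ui_plus.
Proof. by move=> x y z; ui_solve. Qed.

Lemma ui_plusC : commutative ui_plus.
Proof. by move=> x y; ui_solve. Qed.

Lemma ui_plusx0 : right_id ui_zero ui_plus.
Proof. by move=> x; ui_solve. Qed.

Lemma ui_negK : involutive ui_neg.
Proof. by move=> x; ui_solve. Qed.

Lemma ui_plusxN0 (x : I) : ui_plus x (ui_neg ui_zero) = ui_neg ui_zero.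
Proof. ui_solve. Qed.

Lemma ui_lukasiewicz (x y : I) :
  ui_plus (ui_neg (ui_plus (ui_neg x) y)) y =
  ui_plus (ui_neg (ui_plus (ui_neg y) x)) x.
Proof. ui_solve. Qed.

HB.instance Definition _ := isMVAlgebra.Build I
  ui_plusA ui_plusC ui_plusx0 ui_negK ui_plusxN0 ui_lukasiewicz.

End unit_interval.

Section unit_interval_delta.
Context {R : realType}.
Local Notation I := (unit_interval R).
Implicit Types u v : nat -> I.

Lemma ui_plusE (x y : I) : ui_val (mvplus x y) = Num.min (ui_val x + ui_val y) 1.
Proof. by []. Qed.

Lemma ui_negE (x : I) : ui_val (mvneg x) = 1 - ui_val x.
Proof. by []. Qed.

Lemma ui_zeroE : ui_val (mvzero : I) = 0. Proof. by []. Qed.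

Definition ui_term u : R^nat := fun n => ui_val (u n) / 2 ^+ n.+1.

Definition ui_sum u : R := limn (series (ui_term u)).

Lemma ui_term_ge0 u n : 0 <= ui_term u n.
Proof. by rewrite divr_ge0 ?ui_ge0 ?exprn_ge0. Qed.

Lemma ui_term_le u n : ui_term u n <= geometric (2^-1) (2^-1) n.
Proof.
rewrite /ui_term /geometric /= -exprS -exprVn ler_piMl ?exprn_ge0 ?invr_ge0//.
exact: ui_le1.
Qed.

Lemma ui_cvg u : cvgn (series (ui_term u)).
Proof.
apply: (@series_le_cvg _ _ (geometric (2^-1) (2^-1))).
- exact: ui_term_ge0.
- by move=> n; exact: le_trans (ui_term_ge0 u n) (ui_term_le u n).
- exact: ui_term_le.
- by apply: is_cvg_geometric_series; rewrite ger0_norm ?invr_ge0// invf_lt1 ?ltr1n.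
Qed.

Lemma ui_sumS u : ui_sum u = ui_val (u 0%N) / 2 + ui_sum (stail u) / 2.
Proof.
rewrite /ui_sum; apply: cvg_lim => //.
rewrite -(cvg_shiftS (series (ui_term u))).
have -> : (fun n => series (ui_term u) n.+1) =
          (fun n => ui_val (u 0%N) / 2 + series (ui_term (stail u)) n / 2).
  apply/funext => n; rewrite /series /= big_nat_recl //; congr (_ + _).
  rewrite [in RHS]mulr_suml; apply: eq_bigr => i _.
  by rewrite /ui_term /stail -mulrA -invfM -exprSr.
by apply: cvgD; [exact: cvg_cst|apply: cvgMl; exact: ui_cvg].
Qed.

Lemma ui_sum_ge0 u : 0 <= ui_sum u.
Proof.
apply: limr_ge; first exact: ui_cvg.
by apply: nearW => n; apply: sumr_ge0 => i _; exact: ui_term_ge0.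
Qed.

Lemma ui_sum_le u v : (forall n, ui_val (u n) <= ui_val (v n)) ->
  ui_sum u <= ui_sum v.
Proof.
move=> uv; apply: lim_series_le; [exact: ui_cvg|exact: ui_cvg|move=> n].
by rewrite ler_wpM2r ?invr_ge0 ?exprn_ge0.
Qed.

Lemma ui_sum_cst (x : I) : ui_sum (fun=> x) = ui_val x.
Proof. by have := ui_sumS (fun=> x); rewrite /stail; lra. Qed.

Lemma ui_sum_le1 u : ui_sum u <= 1.
Proof.
have one : ui_val (mvneg (mvzero : I)) = 1 by rewrite ui_negE ui_zeroE subr0.
rewrite -one -ui_sum_cst; apply: ui_sum_le => n.
by rewrite one ui_le1.
Qed.

Lemma ui_delta_subproof u : 0 <= ui_sum u <= 1.
Proof. by rewrite ui_sum_ge0 ui_sum_le1. Qed.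

Definition ui_delta u : I := ui_mk (ui_delta_subproof u).

Lemma ui_deltaE u : ui_val (ui_delta u) = ui_sum u. Proof. by []. Qed.

Lemma ui_minusE (x y : I) :
  ui_val (mvminus x y) = Num.max (ui_val x - ui_val y) 0.
Proof.
rewrite /mvminus /mvtimes !(ui_plusE, ui_negE).
by case: leP => ?; case: leP => ?; lra.
Qed.

Lemma ui_distE (x y : I) : ui_val (mvdist x y) = `|ui_val x - ui_val y|.
Proof.
rewrite /mvdist ui_plusE !ui_minusE.
have := ui_ge0 x; have := ui_le1 x; have := ui_ge0 y; have := ui_le1 y.
move: (ui_val x) (ui_val y) => a b ? ? ? ?.
by case: (leP (a - b) 0) => ?; case: (leP (b - a) 0) => ?; case: leP => ?;
  case: (ger0P (a - b)) => ?; lra.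
Qed.

Lemma ui_sum_scons (x : I) u : ui_sum (scons x u) = ui_val x / 2 + ui_sum u / 2.
Proof. by rewrite ui_sumS. Qed.

Lemma ui_halfE (x : I) : ui_val (half_of ui_delta x) = ui_val x / 2.
Proof.
by rewrite /half_of ui_deltaE ui_sum_scons ui_sum_cst ui_zeroE mul0r addr0.
Qed.

Lemma ui_delta_dist u :
  mvdist (ui_delta u) (ui_delta (scons (u 0%N) (fun=> mvzero))) =
  ui_delta (scons mvzero (stail u)).
Proof.
apply: ui_valP; rewrite ui_distE !ui_deltaE !ui_sum_scons ui_sumS.
rewrite ui_sum_cst ui_zeroE mul0r add0r addr0 addrAC subrr add0r.
by rewrite ger0_norm // divr_ge0 // ui_sum_ge0.
Qed.

Lemma ui_half_delta u :
  half_of ui_delta (ui_delta u) = ui_delta (fun n => half_of ui_delta (u n)).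
Proof.
apply: ui_valP; rewrite ui_halfE !ui_deltaE mulrC.
have := lim_seriesZ (2^-1 : R) (@ui_cvg u); rewrite /GRing.scale /= => <-.
congr (limn (series _)); apply/funext => n.
rewrite [RHS]/ui_term ui_halfE; change (2^-1 * ui_term u n = ui_val (u n) / 2 / 2 ^+ n.+1).
by rewrite mulrC mulrAC.
Qed.

Lemma ui_delta_cst (x : I) : ui_delta (fun=> x) = x.
Proof. by apply: ui_valP; exact: ui_sum_cst. Qed.

Lemma ui_delta_scons0 u :
  ui_delta (scons mvzero u) = half_of ui_delta (ui_delta u).
Proof.
by apply: ui_valP; rewrite ui_halfE !ui_deltaE ui_sum_scons ui_zeroE mul0r add0r.
Qed.

Lemma ui_delta_mono u v :
  mvle (ui_delta u) (ui_delta (fun n => mvplus (u n) (v n))).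
Proof.
apply: ui_valP; rewrite ui_minusE; apply/max_idPr; rewrite subr_le0 !ui_deltaE.
apply: ui_sum_le => n; rewrite ui_plusE le_min ui_le1 andbT.
by rewrite lerDl ui_ge0.
Qed.

Lemma ui_half_minus (x y : I) :
  half_of ui_delta (mvminus x y) =
  mvminus (half_of ui_delta x) (half_of ui_delta y).
Proof.
apply: ui_valP; rewrite ui_halfE !ui_minusE !ui_halfE.
by case: leP => ?; case: leP => ?; lra.
Qed.

HB.instance Definition _ := MVAlgebra_isDeltaAlgebra.Build I
  ui_delta_dist ui_half_delta ui_delta_cst ui_delta_scons0 ui_delta_mono
  ui_half_minus.

Lemma ui_plus_cvg (T : Type) (F : set_system T) (f g : T -> I) (a b : I) :
  Filter F -> f @ F --> a -> g @ F --> b ->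
  (fun t => mvplus (f t) (g t)) @ F --> mvplus a b.
Proof.
move=> FF /ui_val_cvg fa /ui_val_cvg gb; apply/ui_val_cvg.
have minE (x y : R) : Num.min x y = (x + y - `|x - y|) / 2.
  by case: leP => xy; case: (ger0P (x - y)) => ?; lra.
suff : (fun t => ui_val (mvplus (f t) (g t))) @ F --> ui_val (mvplus a b) by [].
rewrite ui_plusE minE.
have -> : (fun t => ui_val (mvplus (f t) (g t))) =
  (fun t => (ui_val (f t) + ui_val (g t) + 1 -
            `|ui_val (f t) + ui_val (g t) - 1|) / 2).
  by apply/funext => t; rewrite ui_plusE minE.
have s : (fun t => ui_val (f t) + ui_val (g t)) @ F --> ui_val a + ui_val b.
  exact: cvgD.
apply: cvgMl; apply: cvgB; first by apply: cvgD => //; exact: cvg_cst.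
by apply: cvg_norm; apply: cvgB => //; exact: cvg_cst.
Qed.

Lemma ui_neg_cvg (T : Type) (F : set_system T) (f : T -> I) (a : I) :
  Filter F -> f @ F --> a -> (fun t => mvneg (f t)) @ F --> mvneg a.
Proof.
move=> FF /ui_val_cvg fa; apply/ui_val_cvg.
by apply: cvgB => //; exact: cvg_cst.
Qed.

Lemma ui_delta_near (e : R) : 0 < e -> exists n, forall u v,
  (forall i, (i < n)%N -> `|ui_val (u i) - ui_val (v i)| < e) ->
  `|ui_sum u - ui_sum v| < e + e.
Proof.
move=> e0.
have step n : forall u v,
    (forall i, (i < n)%N -> `|ui_val (u i) - ui_val (v i)| < e) ->
    `|ui_sum u - ui_sum v| <= e + 1 / 2 ^+ n.
  elim: n => [|n IH] u v uv.
    have := ui_delta_subproof u; have := ui_delta_subproof v.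
    by rewrite ler_norml expr0; lra.
  have := uv 0%N isT; have := IH (stail u) (stail v) (fun i => uv i.+1).
  have -> : 1 / 2 ^+ n = 2 * (1 / 2 ^+ n.+1) :> R.
    by rewrite !div1r exprS invfM mulVKf.
  by rewrite (ui_sumS u) (ui_sumS v) ltr_norml !ler_norml; lra.
have : (fun n => 1 / 2 ^+ n : R) @ \oo --> 0.
  have -> : (fun n => 1 / 2 ^+ n : R) = geometric 1 2^-1.
    by apply/funext => n; rewrite /geometric /= exprVn.
  by apply: cvg_geometric; rewrite ger0_norm ?invr_ge0// invf_lt1 ?ltr1n.
move=> /cvgrPdist_lt /(_ e e0) [n _ ne]; exists n => u v uv.
apply: le_lt_trans (step n u v uv) _; rewrite ltrD2l.
have := ne n (leqnn n); rewrite /= sub0r normrN; apply: le_lt_trans.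
exact: ler_norm.
Qed.

Lemma ui_delta_cvg (T : Type) (F : set_system T) (f : nat -> T -> I) u :
  Filter F -> (forall n, f n @ F --> u n) ->
  (fun t => delta (fun n => f n t)) @ F --> delta u.
Proof.
move=> FF fu; apply/ui_val_cvg/cvgrPdist_lt => e e0.
have [n nP] := ui_delta_near (divr_gt0 e0 (ltr0Sn R 1)).
have : \forall t \near F, forall i, (i < n)%N ->
    `|ui_val (u i) - ui_val (f i t)| < e / 2.
  elim: n {nP} => [|n IH]; first exact: nearW.
  have := fu n => /ui_val_cvg/cvgrPdist_lt/(_ _ (divr_gt0 e0 (ltr0Sn R 1))).
  apply: filterS2 IH => t IH fn i; rewrite ltnS leq_eqVlt => /orP[/eqP->//|].
  exact: IH.
by apply: filterS => t /nP; rewrite -splitr.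
Qed.

End unit_interval_delta.

Definition unit_interval_KH (R : realType) : KH :=
  CompactHausdorff (@ui_compact R) (@ui_hausdorff R).

Definition cont01 (R : realType) (X : KH) : Type :=
  hom X (unit_interval_KH R).

Section cont01.
Context {R : realType} {X : compactHausdorff}.
Local Notation I := (unit_interval R).
Local Notation CX := (cont01 R X).
Implicit Types f g h : CX.

Definition c01_fun f : X -> I := (f : continuousType X I).

Lemma c01_cts f : continuous (c01_fun f).
Proof. exact: (@cts_fun _ _ (f : continuousType X I)). Qed.

Definition c01_mk (f : X -> I) (fc : continuous f) : CX :=
  (mkcts fc : continuousType X I).

Lemma c01P f g : c01_fun f =1 c01_fun g -> f = g.
Proof. exact: (@continuousEP X I f g).2. Qed.

Definition c01_zero : CX := c01_mk (@cst_continuous X I mvzero).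

Lemma c01_plus_continuous f g :
  continuous (fun x => mvplus (c01_fun f x) (c01_fun g x)).
Proof. by move=> x; apply: ui_plus_cvg; exact: c01_cts. Qed.

Definition c01_plus f g : CX := c01_mk (@c01_plus_continuous f g).

Lemma c01_neg_continuous f : continuous (fun x => mvneg (c01_fun f x)).
Proof. by move=> x; apply: ui_neg_cvg; exact: c01_cts. Qed.

Definition c01_neg f : CX := c01_mk (@c01_neg_continuous f).

Lemma c01_plusA : associative c01_plus.
Proof. by move=> f g h; apply: c01P => x; exact: mvplusA. Qed.

Lemma c01_plusC : commutative c01_plus.
Proof. by move=> f g; apply: c01P => x; exact: mvplusC. Qed.

Lemma c01_plusx0 : right_id c01_zero c01_plus.
Proof. by move=> f; apply: c01P => x; exact: mvplusx0. Qed.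

Lemma c01_negK : involutive c01_neg.
Proof. by move=> f; apply: c01P => x; exact: mvnegK. Qed.

Lemma c01_plusxN0 f : c01_plus f (c01_neg c01_zero) = c01_neg c01_zero.
Proof. by apply: c01P => x; exact: mvplusxN0. Qed.

Lemma c01_lukasiewicz f g :
  c01_plus (c01_neg (c01_plus (c01_neg f) g)) g =
  c01_plus (c01_neg (c01_plus (c01_neg g) f)) f.
Proof. by apply: c01P => x; exact: mvplus_lukasiewicz. Qed.

HB.instance Definition _ := isMVAlgebra.Build CX
  c01_plusA c01_plusC c01_plusx0 c01_negK c01_plusxN0 c01_lukasiewicz.

(* At each point this is the series defining [delta] on [0, 1]. *)
Lemma c01_delta_continuous (g : nat -> CX) :
  continuous (fun x => delta (fun n => c01_fun (g n) x)).
Proof. by move=> x; apply: ui_delta_cvg => n; exact: c01_cts. Qed.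

Definition c01_delta (g : nat -> CX) : CX := c01_mk (@c01_delta_continuous g).

Lemma c01_funE (u : nat -> CX) x :
  c01_fun (c01_delta u) x = delta (fun n => c01_fun (u n) x).
Proof. by []. Qed.

Lemma c01_scons f (u : nat -> CX) x :
  (fun n => c01_fun (scons f u n) x) =
  scons (c01_fun f x) (fun n => c01_fun (u n) x).
Proof. by apply/funext; case. Qed.

Lemma c01_half f x :
  c01_fun (half_of c01_delta f) x = half_of delta (c01_fun f x).
Proof. by rewrite /half_of c01_funE c01_scons. Qed.

Lemma c01_delta_dist (u : nat -> CX) :
  mvdist (c01_delta u) (c01_delta (scons (u 0%N) (fun=> mvzero))) =
  c01_delta (scons mvzero (stail u)).
Proof.
apply: c01P => x; rewrite c01_funE c01_scons.
rewrite -[RHS](delta_dist (fun n => c01_fun (u n) x)).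
change (mvdist (c01_fun (c01_delta u) x)
  (c01_fun (c01_delta (scons (u 0%N) (fun=> mvzero))) x) =
  mvdist (c01_fun (c01_delta u) x)
  (delta (scons (c01_fun (u 0%N) x) (fun=> mvzero)))).
by rewrite !c01_funE c01_scons.
Qed.

Lemma c01_half_delta (u : nat -> CX) :
  half_of c01_delta (c01_delta u) =
  c01_delta (fun n => half_of c01_delta (u n)).
Proof.
apply: c01P => x; rewrite c01_half !c01_funE half_delta.
by congr delta; apply/funext => n; rewrite c01_half.
Qed.

Lemma c01_delta_cst f : c01_delta (fun=> f) = f.
Proof. by apply: c01P => x; exact: delta_cst. Qed.

Lemma c01_delta_scons0 (u : nat -> CX) :
  c01_delta (scons mvzero u) = half_of c01_delta (c01_delta u).
Proof.
by apply: c01P => x; rewrite c01_half !c01_funE c01_scons delta_scons0.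
Qed.

Lemma c01_delta_mono (u v : nat -> CX) :
  mvle (c01_delta u) (c01_delta (fun n => mvplus (u n) (v n))).
Proof.
apply: c01P => x.
exact: (delta_mono (fun n => c01_fun (u n) x) (fun n => c01_fun (v n) x)).
Qed.

Lemma c01_half_minus f g :
  half_of c01_delta (mvminus f g) =
  mvminus (half_of c01_delta f) (half_of c01_delta g).
Proof.
apply: c01P => x; rewrite c01_half.
change (half_of delta (mvminus (c01_fun f x) (c01_fun g x)) =
  mvminus (c01_fun (half_of c01_delta f) x)
          (c01_fun (half_of c01_delta g) x)).
by rewrite !c01_half half_minus.
Qed.

HB.instance Definition _ := MVAlgebra_isDeltaAlgebra.Build CX
  c01_delta_dist c01_half_delta c01_delta_cst c01_delta_scons0 c01_delta_mono
  c01_half_minus.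

End cont01.

Section cont_functor.
Context (R : realType).
Local Notation I := (unit_interval_KH R).

Definition cont_precomp (X Y : KH) (f : hom X Y) (g : cont01 R Y) :
  cont01 R X := comp g f.

Section cont_mor.
Context (X Y : KH) (f : hom X Y).

Lemma cont_precomp0 : cont_precomp f mvzero = mvzero.
Proof. exact: c01P. Qed.

Lemma cont_precompD : {morph cont_precomp f : g h / mvplus g h}.
Proof. by move=> g h; exact: c01P. Qed.

Lemma cont_precompN : {morph cont_precomp f : g / mvneg g}.
Proof. by move=> g; exact: c01P. Qed.

Lemma cont_precomp_delta (g : nat -> cont01 R Y) :
  cont_precomp f (delta g) = delta (fun n => cont_precomp f (g n)).
Proof. exact: c01P. Qed.

Definition cont_mor : @hom Delta (cont01 R Y) (cont01 R X) :=
  DeltaHom cont_precomp0 cont_precompD cont_precompN cont_precomp_delta.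

End cont_mor.

Lemma cont_mor_id (X : KH) : cont_mor (idm X) = idm (cont01 R X : Delta).
Proof. by apply: deltaHomP => g; exact: compm1. Qed.

Lemma cont_mor_comp (X Y Z : KH) (g : hom Y Z) (f : hom X Y) :
  cont_mor (comp g f) = comp (cont_mor f) (cont_mor g).
Proof. by apply: deltaHomP => h; exact: compA. Qed.

Definition cont_functor : contravariant_functor KH Delta :=
  @ContravariantFunctor KH Delta (fun X => cont01 R X : deltaAlgebraType)
    cont_mor cont_mor_id cont_mor_comp.

End cont_functor.

Definition dhom01 (R : realType) (A : Delta) : Type :=
  hom A (unit_interval R : Delta).

Definition dhom_eval (R : realType) (A : deltaAlgebraType) (a : A)
  (h : dhom01 R A) : unit_interval R := (h : deltaHom A (unit_interval R)) a.

HB.instance Definition _ (R : realType) (A : Delta) :=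
  gen_eqMixin (dhom01 R A).
HB.instance Definition _ (R : realType) (A : Delta) :=
  gen_choiceMixin (dhom01 R A).

(* The supremum, over all [a], of the initial topologies of the single
   evaluation maps is the initial topology of the whole family. *)
HB.instance Definition _ (R : realType) (A : Delta) :=
  Topological.copy (dhom01 R A)
    (sup_topology (fun a : A =>
       Topological.class (initial_topology (@dhom_eval R A a)))).

Section dhom_space.
Context (R : realType) (A : Delta).
Local Notation I := (unit_interval R).
Local Notation S := (dhom01 R A).

Lemma dhom_cvg (F : set_system S) (s : S) : Filter F ->
  F --> s <-> forall a : A, dhom_eval a @ F --> dhom_eval a s.
Proof.
move=> FF; split=> [/cvg_sup Fs a|Fs].
  by apply/(@cvg_initial S I (@dhom_eval R A a)); exact: Fs.
by apply/cvg_sup => a; apply/(@cvg_initial S I (@dhom_eval R A a)); exact: Fs.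
Qed.

Lemma dhom_eval_continuous (a : A) : continuous (@dhom_eval R A a).
Proof. by move=> s; have /dhom_cvg := @cvg_id S (nbhs s); exact. Qed.

Lemma dhomP (s t : S) : (forall a : A, dhom_eval a s = dhom_eval a t) -> s = t.
Proof. exact: deltaHomP. Qed.

Lemma dhom_hausdorff : hausdorff_space S.
Proof.
move=> s t st; apply: dhomP => a; apply: ui_hausdorff => U V sU tV.
have [h [Uh Vh]] :=
  st _ _ (dhom_eval_continuous sU) (dhom_eval_continuous tV).
by exists (dhom_eval a h).
Qed.

Lemma ultra_cvg (T : Type) (X : topologicalType) (f : T -> X)
    (F : set_system T) : compact [set: X] -> UltraFilter F ->
  exists x : X, f @ F --> x.
Proof.
move=> cX FU; have [x [_ Fx]] := cX (f @ F) _ filterT.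
exists x => U; rewrite nbhsE => -[V oV VU].
have [FV|FV] := in_ultra_setVsetC (f @^-1` V) FU.
  by apply: filterS FV => t; exact: VU.
have [y [nVy Vy]] := Fx (~` V) V FV (open_nbhs_nbhs oV).
by [].
Qed.

Lemma dhom_compact : compact [set: S].
Proof.
rewrite compact_ultra => F FU _.
pose l (a : A) : I :=
  projT1 (cid (ultra_cvg (@dhom_eval R A a) (@ui_compact R) FU)).
have lP (a : A) : dhom_eval a @ F --> l a by rewrite /l; case: cid.
have lU (a : A) (x : I) : dhom_eval a @ F --> x -> l a = x.
  by move=> Fx; exact: (cvg_unique (@ui_hausdorff R) (lP a) Fx).
have l0 : l mvzero = mvzero.
  apply: lU; have -> : @dhom_eval R A mvzero = fun=> mvzero.
    by apply/funext => h; exact: delta_fun0.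
  exact: cvg_cst.
have lD : {morph l : a b / mvplus a b}.
  move=> a b; apply: lU.
  have -> : dhom_eval (mvplus a b) =
      (fun h : S => mvplus (dhom_eval a h) (dhom_eval b h)).
    by apply/funext => h; exact: delta_funD.
  by apply: ui_plus_cvg; exact: lP.
have lN : {morph l : a / mvneg a}.
  move=> a; apply: lU.
  have -> : dhom_eval (mvneg a) = (fun h : S => mvneg (dhom_eval a h)).
    by apply/funext => h; exact: delta_funN.
  by apply: ui_neg_cvg; exact: lP.
have ld (a : nat -> A) : l (delta a) = delta (fun n => l (a n)).
  apply: lU.
  have -> : dhom_eval (delta a) =
      (fun h : S => delta (fun n => dhom_eval (a n) h)).
    by apply/funext => h; exact: delta_fun_delta.
  by apply: ui_delta_cvg => n; exact: lP.
exists (DeltaHom l0 lD lN ld : S); split=> //.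
by apply/dhom_cvg => a; exact: lP.
Qed.

Definition dhom_space : KH := CompactHausdorff dhom_compact dhom_hausdorff.

End dhom_space.

Section dhom_functor.
Context (R : realType).

Definition dhom_precomp (A B : Delta) (f : hom A B) (h : dhom01 R B) :
  dhom01 R A := comp h f.

Lemma dhom_precomp_continuous (A B : Delta) (f : hom A B) :
  continuous (dhom_precomp f).
Proof.
move=> h; have FF : Filter (dhom_precomp f @ nbhs h).
  by apply: fmap_filter; exact: nbhs_filter.
apply: (dhom_cvg _ FF).2 => a.
exact: (@dhom_eval_continuous R B ((f : deltaHom A B) a)).
Qed.

Definition dhom_mor (A B : Delta) (f : hom A B) :
    hom (dhom_space R B) (dhom_space R A) :=
  (mkcts (@dhom_precomp_continuous A B f) :
     continuousType (dhom01 R B) (dhom01 R A)).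

Lemma dhom_mor_id (A : Delta) : dhom_mor (idm A) = idm (dhom_space R A).
Proof. by apply/continuousEP => h; exact: compm1. Qed.

Lemma dhom_mor_comp (A B C : Delta) (g : hom B C) (f : hom A B) :
  dhom_mor (comp g f) = comp (dhom_mor f) (dhom_mor g).
Proof. by apply/continuousEP => h; exact: compA. Qed.

Definition dhom_functor : contravariant_functor Delta KH :=
  ContravariantFunctor dhom_mor_id dhom_mor_comp.

End dhom_functor.

(* Main.v *)
(** Every δ-algebra satisfies [delta x = x_0 / 2 + delta (x_1, x_2, ...) / 2]
    with an exact sum, so any MV-homomorphism to [[0, 1]] preserves δ.  An
    element [a] below every [2 ^- n] vanishes, because [a + a + ...] is then
    the δ of a sequence.  If [a <> 0], then [a] is not below some [2 ^- n]; a
    prime ideal avoiding [a - 2 ^- n] has a totally ordered quotient, in which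
    comparison with the dyadic constants defines a homomorphism to [[0, 1]]
    that does not kill [a].  So [A -> C(hom(A, [0, 1]))] is injective.  For
    surjectivity, the lattice form of Stone-Weierstrass approximates a
    continuous [g] within [1/4], which produces a digit [a] in [A] with
    [2 g - 1 <= a <= 2 g]; iterating with [2 g - a] in place of [g] writes [g]
    as the δ of its digits.  For a compact Hausdorff [X], points are separated
    by Urysohn's lemma, and a homomorphism other than an evaluation would, by
    compactness, send [1] to [0]. *)
Require Import Defs.
From HB Require Import structures.
From mathcomp Require Import all_boot all_order all_algebra.
From mathcomp Require Import all_classical all_reals all_analysis.
From mathcomp Require Import zify lra.
Import Order.TTheory GRing.Theory Num.Theory.
Import numFieldNormedType.Exports.

Set Implicit Arguments.
Unset Strict Implicit.
Unset Printing Implicit Defensive.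

Local Open Scope classical_set_scope.
Local Open Scope ring_scope.

Local Notation "x ⊕ y" := (mvplus x y) (at level 50, left associativity).
Local Notation "x ⊖ y" := (mvminus x y) (at level 50, left associativity).
Local Notation "¬ x" := (mvneg x) (at level 35, right associativity).
Local Notation "x ≤ y" := (mvle x y) (at level 70, no associativity).

(** * MV-algebras *)

Definition mvmul (A : mvAlgebraType) (n : nat) (x : A) : A :=
  iter n (mvplus x) mvzero.

Section mv_order.
Context {A : mvAlgebraType}.
Implicit Types x y z u v : A.
Local Notation o := (@mvzero A).
Local Notation i := (@mvone A).

Lemma mvplus0x x : o ⊕ x = x.
Proof. by rewrite mvplusC mvplusx0. Qed.

Lemma mvplusx1 x : x ⊕ i = i.
Proof. exact: mvplusxN0. Qed.

Lemma mvplus1x x : i ⊕ x = i.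
Proof. by rewrite mvplusC mvplusx1. Qed.

Lemma mvplusCA x y z : x ⊕ (y ⊕ z) = y ⊕ (x ⊕ z).
Proof. by rewrite !mvplusA [x ⊕ y]mvplusC. Qed.

Lemma mvneg1 : ¬ i = o. Proof. exact: mvnegK. Qed.

(** The Łukasiewicz axiom for [x] and 1: one side is absorbed to 1, the other collapses to
    [¬ x ⊕ x]. *)
Lemma mvplusNx x : ¬ x ⊕ x = i.
Proof.
have := mvplus_lukasiewicz x i.
by rewrite !mvplusx1 mvneg1 mvplus0x => <-.
Qed.

Lemma mvleP x y : x ≤ y <-> ¬ x ⊕ y = i.
Proof.
rewrite /mvle /mvminus /mvtimes mvnegK; split=> [E|->]; last exact: mvneg1.
by rewrite -[LHS]mvnegK E.
Qed.

Lemma mvle_plusr x y : x ≤ x ⊕ y.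
Proof. by apply/mvleP; rewrite mvplusA mvplusNx mvplus1x. Qed.

Lemma mvle_plusl x y : x ≤ y ⊕ x.
Proof. by rewrite mvplusC; exact: mvle_plusr. Qed.

Lemma mvminusE x y : x ⊖ y = ¬ (¬ x ⊕ y).
Proof. by rewrite /mvminus /mvtimes mvnegK. Qed.

(** Each side is the join of [x] and [y], so the Łukasiewicz axiom expresses its commutativity. *)
Lemma mvsupC x y : (x ⊖ y) ⊕ y = (y ⊖ x) ⊕ x.
Proof. by rewrite !mvminusE mvplus_lukasiewicz. Qed.

Lemma mvminusK x y : y ≤ x -> (x ⊖ y) ⊕ y = x.
Proof. by rewrite mvsupC => ->; rewrite mvplus0x. Qed.

Lemma mvle_refl x : x ≤ x.
Proof. by apply/mvleP; exact: mvplusNx. Qed.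

Lemma mvle_anti x y : x ≤ y -> y ≤ x -> x = y.
Proof. by move=> xy yx; rewrite -(mvminusK yx) xy mvplus0x. Qed.

Lemma mvle_trans y x z : x ≤ y -> y ≤ z -> x ≤ z.
Proof.
move=> xy yz; rewrite -(mvminusK yz) -(mvminusK xy) mvplusA.
exact: mvle_plusl.
Qed.

Lemma mvle0x x : o ≤ x.
Proof. by rewrite -(mvplus0x x); exact: mvle_plusr. Qed.

Lemma mvlex1 x : x ≤ i.
Proof. by apply/mvleP; exact: mvplusx1. Qed.

Lemma mvlex0 x : x ≤ o -> x = o.
Proof. by move=> x0; apply: mvle_anti x0 (mvle0x x). Qed.

Lemma mvle_plus2r z x y : x ≤ y -> x ⊕ z ≤ y ⊕ z.
Proof. by move=> xy; rewrite -(mvminusK xy) -mvplusA; exact: mvle_plusl. Qed.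

Lemma mvle_plus x y u v : x ≤ y -> u ≤ v -> x ⊕ u ≤ y ⊕ v.
Proof.
move=> xy uv; apply: mvle_trans (mvle_plus2r u xy) _.
by rewrite ![y ⊕ _]mvplusC; exact: mvle_plus2r.
Qed.

Lemma mvle_neg x y : x ≤ y -> ¬ y ≤ ¬ x.
Proof. by move=> /mvleP xy; apply/mvleP; rewrite mvnegK mvplusC. Qed.

(** Residuation; the triangle inequality and the subadditivity of [⊖] below follow from it. *)
Lemma mvle_minusl x y z : x ⊖ y ≤ z <-> x ≤ y ⊕ z.
Proof. by rewrite !mvleP mvminusE mvnegK mvplusA. Qed.

Lemma mvle_minus x y u v : x ≤ y -> v ≤ u -> x ⊖ u ≤ y ⊖ v.
Proof.
move=> xy vu; rewrite !mvminusE; apply/mvle_neg/mvle_plus => //.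
exact: mvle_neg.
Qed.

Lemma mvle_minusx x y : x ⊖ y ≤ x.
Proof. by apply/mvle_minusl; exact: mvle_plusl. Qed.

Lemma mvle_minus_plus x y : x ≤ y ⊕ (x ⊖ y).
Proof. by apply/mvle_minusl; exact: mvle_refl. Qed.

Lemma mvminus_triangle y x z : x ⊖ z ≤ (x ⊖ y) ⊕ (y ⊖ z).
Proof.
apply/mvle_minusl; rewrite mvplusCA mvplusC.
apply: mvle_trans (mvle_minus_plus x y) _.
by apply: mvle_plus2r; exact: mvle_minus_plus.
Qed.

Lemma mvminus_plus x y u v : (x ⊕ u) ⊖ (y ⊕ v) ≤ (x ⊖ y) ⊕ (u ⊖ v).
Proof.
apply/mvle_minusl; rewrite -mvplusA [v ⊕ _]mvplusCA mvplusA.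
by apply: mvle_plus; exact: mvle_minus_plus.
Qed.

Lemma mvminus_neg x y : ¬ x ⊖ ¬ y = y ⊖ x.
Proof. by rewrite !mvminusE mvnegK mvplusC. Qed.

(** The hypothesis says that the sum is not truncated, which is what allows [y] to cancel. *)
Lemma mvplusK x y : x ≤ ¬ y -> (x ⊕ y) ⊖ y = x.
Proof.
move=> /mvle_neg; rewrite mvnegK => /mvminusK yx.
by rewrite -[RHS]mvnegK -yx !mvminusE mvnegK.
Qed.

Lemma mvle_sup x y z : x ≤ z -> y ≤ z -> (x ⊖ y) ⊕ y ≤ z.
Proof.
move=> xz yz; rewrite -(mvminusK yz); apply: mvle_plus2r.
by apply: mvle_minus => //; exact: mvle_refl.
Qed.

(** [x ⊖ (x ⊖ y)] is the meet, De Morgan dual to the join of [mvle_sup]. *)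
Lemma mvle_inf x y z : z ≤ x -> z ≤ y -> z ≤ x ⊖ (x ⊖ y).
Proof.
move=> /mvle_neg zx /mvle_neg zy; have := mvle_neg (mvle_sup zy zx).
by rewrite !mvminusE !mvnegK mvplusC [y ⊕ _]mvplusC.
Qed.

(** With [m] the meet of [x] and [y], the sum [z ⊕ m] is untruncated and lies below both [x] and
    [y], hence below [m]; cancelling [m] leaves [z = o]. *)
Lemma mvminus_disjoint x y z : z ≤ x ⊖ y -> z ≤ y ⊖ x -> z = o.
Proof.
pose m := x ⊖ (x ⊖ y).
have mx : m ≤ x by exact: mvle_minusx.
have my : m ≤ y by apply/mvle_minusl; rewrite mvsupC; exact: mvle_plusl.
have zm u v : m ≤ u -> m ≤ v -> z ≤ u ⊖ v -> z ⊕ m ≤ u.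
  move=> mu mv zuv; rewrite -(mvminusK mu); apply: mvle_plus2r.
  by apply: mvle_trans zuv _; apply: mvle_minus => //; exact: mvle_refl.
move=> zxy zyx; have zNm : z ≤ ¬ m.
  apply: mvle_trans zxy _; rewrite mvminusE; apply: mvle_neg.
  by apply: mvle_trans my _; exact: mvle_plusl.
rewrite -(mvplusK zNm).
by have := mvle_inf (zm _ _ mx my zxy) (zm _ _ my mx zyx).
Qed.

(** By residuation [z ⊖ v] lies below both [u] and [w], so it vanishes and [z ≤ v]. *)
Lemma mvplus_disjoint u v w :
  (forall z, z ≤ u -> z ≤ v -> z = o) -> (forall z, z ≤ u -> z ≤ w -> z = o) ->
  forall z, z ≤ u -> z ≤ v ⊕ w -> z = o.
Proof.
move=> uv uw z zu zvw; apply: (uv) => //; apply: uw; last exact/mvle_minusl.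
by apply: mvle_trans zu; exact: mvle_minusx.
Qed.

Lemma mvmul_disjoint n u v :
  (forall z, z ≤ u -> z ≤ v -> z = o) ->
  forall z, z ≤ u -> z ≤ mvmul n v -> z = o.
Proof.
move=> uv; elim: n => [|n IH] z zu; first exact: mvlex0.
exact: (mvplus_disjoint uv IH).
Qed.

Lemma mvmulD m n x : mvmul (m + n) x = mvmul m x ⊕ mvmul n x.
Proof.
by elim: m => [|m IH]; rewrite ?add0n ?mvplus0x// addSn /= IH mvplusA.
Qed.

Lemma mvle_mul m n x : (m <= n)%N -> mvmul m x ≤ mvmul n x.
Proof. by move=> /subnK <-; rewrite mvmulD; exact: mvle_plusl. Qed.

End mv_order.

(** * Halving in δ-algebras *)

Section delta_algebra.
Context {A : deltaAlgebraType}.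
Implicit Types (x y z : A) (u v : nat -> A).
Local Notation o := (@mvzero A).
Local Notation i := (@mvone A).
Local Notation half := (half_of (@delta A)).

Lemma delta_le u v : (forall n, u n ≤ v n) -> delta u ≤ delta v.
Proof.
move=> uv; have -> : v = (fun n => u n ⊕ (v n ⊖ u n)).
  by apply/funext => n; rewrite mvplusC mvminusK.
exact: delta_mono.
Qed.

Lemma half_le x y : x ≤ y -> half x ≤ half y.
Proof. by move=> xy; apply: delta_le => -[|n] //=; exact: mvle_refl. Qed.

Lemma half_lex x : half x ≤ x.
Proof.
rewrite -[X in _ ≤ X]delta_cst; apply: delta_le => -[|n] /=.
  exact: mvle_refl.
exact: mvle0x.
Qed.

(** Axiom A1 at a constant sequence: the distance from [x] to its half is [delta] of [0, x, x, ...],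
    which is the half again. *)
Lemma minus_half x : x ⊖ half x = half x.
Proof.
have := delta_dist (fun=> x).
rewrite delta_scons0 delta_cst -/(half x) /mvdist.
by rewrite (half_lex x : half x ⊖ x = o) mvplusx0.
Qed.

Lemma half_plus x : half x ⊕ half x = x.
Proof. by rewrite -{1}minus_half mvminusK//; exact: half_lex. Qed.

Lemma half_one : half i = ¬ half i.
Proof. by rewrite -{1}minus_half mvminusE mvneg1 mvplus0x. Qed.

(** Sums of two halves are therefore never truncated. *)
Lemma half_leN x y : half x ≤ ¬ half y.
Proof.
apply: mvle_trans (half_le (mvlex1 x)) _; rewrite half_one.
exact/mvle_neg/half_le/mvlex1.
Qed.

(** Axiom A6 only concerns differences; an untruncated sum is reduced to one by writing [x] as
    [(x ⊕ y) ⊖ y]. *)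
Lemma halfD x y : x ≤ ¬ y -> half (x ⊕ y) = half x ⊕ half y.
Proof.
move=> xy; rewrite -{2}(mvplusK xy) half_minus mvminusK//.
exact/half_le/mvle_plusl.
Qed.

(** As [half (u 0%N) ≤ delta u], the distance in axiom A1 is a plain difference, and adding the half
    back recovers [delta u]. *)
Lemma deltaE u : delta u = half (u 0%N) ⊕ half (delta (stail u)).
Proof.
have le0 : half (u 0%N) ≤ delta u.
  by apply: delta_le => -[|n] /=; [exact: mvle_refl|exact: mvle0x].
have := delta_dist u; rewrite delta_scons0 -/(half (u 0%N)) /mvdist => <-.
by rewrite (le0 : half (u 0%N) ⊖ delta u = o) mvplusx0 mvplusC mvminusK.
Qed.

Definition mvdyadic (n : nat) : A := iter n half i.

Lemma mvdyadic_plus n : mvdyadic n.+1 ⊕ mvdyadic n.+1 = mvdyadic n.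
Proof. exact: half_plus. Qed.

(* If [x <= 2 ^- n] for all [n], then the sum [s = x + x + ...] can be written
   as the [delta] of [2 x, 4 x, ...]; it satisfies [s = x + s] and cancels. *)
Lemma delta_archimedean x : (forall n, x ≤ mvdyadic n) -> x = o.
Proof.
move=> xe; pose b n := iter n (fun y => y ⊕ y) x.
have be n k : b n ≤ mvdyadic k.
  elim: n k => [|n IH] k; first exact: xe.
  by rewrite -mvdyadic_plus; apply: mvle_plus; exact: IH.
have bS n : half (b n.+1) = b n.
  rewrite /b iterS -/(b n) halfD ?half_plus//.
  apply: mvle_trans (be n 1%N) _; rewrite /mvdyadic /= half_one.
  by apply: mvle_neg; exact: (be n 1%N).
pose s := delta (stail b).
have sE : s = x ⊕ s.
  rewrite {1}/s deltaE {1}/stail bS half_delta; congr (_ ⊕ delta _).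
  by apply/funext => n; rewrite /stail bS.
(* Both [x] and [s] are halves, so the sum in [s = x ⊕ s] is untruncated and cancels. *)
have hs : s = half (delta (stail (stail b))).
  by rewrite half_delta; congr delta; apply/funext => n; rewrite /stail bS.
have xs : x ≤ ¬ s by rewrite hs -[x](bS 0%N); exact: half_leN.
by rewrite -(mvplusK xs) -sE; exact: mvle_refl.
Qed.

Lemma halfN x : half i ⊕ half (¬ x) = ¬ half x.
Proof.
have -> : ¬ x = i ⊖ x by rewrite mvminusE mvneg1 mvplus0x.
rewrite half_minus mvminusE -half_one mvplusC.
by rewrite -[RHS](mvminusK (half_leN i x)) mvminusE mvnegK [half x ⊕ _]mvplusC.
Qed.

Lemma mvmul_dyadic m n k :
  mvmul k (mvdyadic n) = mvmul (k * 2 ^ m) (mvdyadic (n + m)).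
Proof.
elim: m => [|m ->]; first by rewrite expn0 muln1 addn0.
rewrite addnS expnSr mulnA; move: (k * 2 ^ m)%N => {}k.
elim: k => [//|k IH]; rewrite mulSn mulnC mvmulD mulnC -IH.
by rewrite /= mvplusx0 mvdyadic_plus.
Qed.

Lemma mvmul_dyadic1 n : mvmul (2 ^ n) (mvdyadic n) = i.
Proof. by have := mvmul_dyadic n 0 1; rewrite mul1n /= mvplusx0. Qed.

(** Induction on [n]. Up to exchanging [k] and [l], [k] is at most [2 ^ n]; then the multiple at
    level [n.+1] is the half of the one at level [n], and [halfN] applies. *)
Lemma mvmul_dyadicN n k l :
  (k + l = 2 ^ n)%N -> ¬ mvmul k (mvdyadic n) = mvmul l (mvdyadic n).
Proof.
elim: n k l => [|n IH] k l.
  move: k l => [|[|k]] [|[|l]]//= _; rewrite ?mvplusx0 ?mvneg1//.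
have hM j : (j <= 2 ^ n)%N ->
    half (mvmul j (mvdyadic n)) = mvmul j (mvdyadic n.+1).
  elim: j => [_|j IHj jn]; first by have := delta_cst o; rewrite /half_of /=;
    congr (delta _ = _); apply/funext => -[].
  rewrite /= halfD ?IHj//; first exact: ltnW.
  rewrite (IH j (2 ^ n - j)%N) ?subnKC//; last exact: ltnW.
  rewrite -{1}[mvdyadic n]mvplusx0; apply: (@mvle_mul _ 1).
  by rewrite subn_gt0.
wlog kn : k l / (k <= 2 ^ n)%N => [H kl|kl].
  have [/H|nk] := leqP k (2 ^ n); first exact.
  rewrite -(H l k) ?mvnegK; rewrite ?(addnC l)//.
  by move: kl; rewrite expnS; lia.
have -> : l = (2 ^ n + (2 ^ n - k))%N by move: kl; rewrite expnS; lia.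
rewrite mvmulD -!hM ?leq_subr// mvmul_dyadic1 -(IH k (2 ^ n - k)%N) ?subnKC//.
by rewrite halfN.
Qed.

End delta_algebra.

(** * Prime ideals and homomorphisms to the unit interval *)

Definition mvideal (A : mvAlgebraType) (J : set A) : Prop :=
  [/\ J mvzero, forall x y, x ≤ y -> J y -> J x &
      forall x y, J x -> J y -> J (x ⊕ y)].

Section mv_ideal.
Context {A : mvAlgebraType}.
Implicit Types (x y z : A) (J : set A).
Local Notation o := (@mvzero A).

Definition mvcone J x : set A :=
  [set y | exists n j, J j /\ y ≤ mvmul n x ⊕ j].

Lemma mvcone_ideal J x : mvideal J -> mvideal (mvcone J x).
Proof.
move=> [J0 _ JD]; split.
- by exists 0%N, o; split=> //; exact: mvle0x.
- move=> y z yz [n [j [Jj zj]]]; exists n, j; split=> //.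
  exact: mvle_trans zj.
- move=> y z [n [j [Jj yj]]] [m [k [Jk zk]]].
  exists (n + m)%N, (j ⊕ k); split; first exact: JD.
  apply: mvle_trans (mvle_plus yj zk) _.
  rewrite mvmulD -!mvplusA [j ⊕ (_ ⊕ _)]mvplusCA; exact: mvle_refl.
Qed.

Lemma mvideal_avoiding (b : A) : b <> o ->
  exists J, [/\ mvideal J, ~ J b &
    forall K, mvideal K -> J `<=` K -> ~ K b -> K `<=` J].
Proof.
(* Zorn's lemma also ranges over the empty chain; adjoining [o] turns its empty union into the zero
   ideal. *)
move=> b0; pose P (X : set A) := mvideal (o |` X) /\ ~ X b.
have [F FP Ftot|X [[XI Xb] Xmax]] := @Zorn_bigcup A P.
  split; last by move=> [X /FP[_]].
  have ch x y : (o |` \bigcup_(X in F) X) x -> (o |` \bigcup_(X in F) X) y ->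
      (x = o /\ y = o) \/ exists X, [/\ F X, (o |` X) x & (o |` X) y].
    move=> [xo|[X FX Xx]] [yo|[Y FY Yy]].
    - by left.
    - by right; exists Y; split=> //; [left|right].
    - by right; exists X; split=> //; [right|left].
    - by right; have [XY|YX] := Ftot _ _ FX FY; [exists Y|exists X];
        split=> //; right => //; [exact: XY|exact: YX].
  have sub X : F X -> o |` X `<=` o |` \bigcup_(X in F) X.
    by move=> FX x [->|Xx]; [left|right; exists X].
  split; first by left.
  - move=> x y xy Fy; have [[_ yo]|[X [FX _ Xy]]] := ch _ _ Fy Fy.
      by left; apply: mvlex0; rewrite -yo.
    by apply: (sub _ FX); have [[_ Xle _] _] := FP _ FX; exact: Xle Xy.
  - move=> x y Fx Fy; have [[-> ->]|[X [FX Xx Xy]]] := ch _ _ Fx Fy.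
      by left; rewrite mvplusx0.
    by apply: (sub _ FX); have [[_ _ XD] _] := FP _ FX; exact: XD.
exists (o |` X); split=> // [[]//|K KI XK Kb].
have [K0 _ _] := KI.
have KE : o |` K = K by apply/seteqP; split=> [x [->//|]|x Kx] //; right.
move=> x Kx; right; apply: contrapT => Xx.
apply: (Xmax K); last by split=> //; rewrite KE.
by split=> [|KX]; [move=> y Xy; apply: XK; right|exact/Xx/KX].
Qed.

(* An ideal maximal among those avoiding [b] is prime. *)
Lemma mvideal_prime_avoiding (b : A) : b <> o ->
  exists J, [/\ mvideal J, ~ J b & forall x y, J (x ⊖ y) \/ J (y ⊖ x)].
Proof.
move=> /mvideal_avoiding[J [JI Jb Jmax]]; exists J; split=> // x y.
have [J0 Jle JD] := JI.
apply: contrapT => /not_orP[Ju Jv].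
have out u : ~ J u -> exists n j, J j /\ b ≤ mvmul n u ⊕ j.
  move=> Ju'; apply: contrapT => nb; apply: (Ju').
  apply: (Jmax (mvcone J u)) => //; first exact: mvcone_ideal.
    by move=> j Jj; exists 0%N, j; split=> //; exact: mvle_plusl.
  exists 1%N, o; split=> //.
  by rewrite /= !mvplusx0; exact: mvle_refl.
have [n [j [Jj bj]]] := out _ Ju; have [m [k [Jk bk]]] := out _ Jv.
apply: Jb; apply: (Jle _ (j ⊕ k)); last exact: JD.
(* Multiples of the disjoint elements [x ⊖ y] and [y ⊖ x] stay disjoint, so [b ⊖ (j ⊕ k)], which
   lies below both, vanishes. *)
have dis z : z ≤ mvmul n (x ⊖ y) -> z ≤ mvmul m (y ⊖ x) -> z = o.
  move=> zn; move: z zn; apply: mvmul_disjoint => z zn zy; move: z zy zn.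
  by apply: mvmul_disjoint => z zy zx; exact: mvminus_disjoint zx zy.
apply: (dis (b ⊖ (j ⊕ k))); apply/mvle_minusl; rewrite mvplusC.
- by apply: mvle_trans bj _; rewrite mvplusA; exact: mvle_plusr.
- by apply: mvle_trans bk _; rewrite [j ⊕ k]mvplusC mvplusA; exact: mvle_plusr.
Qed.

End mv_ideal.

(** * Dyadic approximation and binary expansion of reals *)

Section real_lemmas.
Context {R : realType}.
Implicit Types (a b r : R).

Lemma eq_dyadic a b c : (forall n, `|a - b| <= c / 2 ^+ n) -> a = b.
Proof.
move=> H; apply/eqP; rewrite -subr_eq0 -normr_le0.
have : (fun n => geometric c 2^-1 n : R) @ \oo --> 0.
  by apply: cvg_geometric; rewrite ger0_norm ?invr_ge0// invf_lt1 ?ltr1n.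
move=> /(@cvg_lim _ (@norm_hausdorff R R)) <-.
apply: limr_ge.
  apply/cvg_ex; exists 0; apply: cvg_geometric.
  by rewrite ger0_norm ?invr_ge0// invf_lt1 ?ltr1n.
by apply: nearW => n; rewrite /geometric /= exprVn; exact: H.
Qed.

(** Each unfolding of the recursion halves the distance between the two sides, which is at most 1 at
    the start. Later sums are identified this way, without partial sums. *)
Lemma ui_sum_unique (u : nat -> unit_interval R) (r : nat -> R) :
  (forall n, 0 <= r n <= 1) ->
  (forall n, r n = ui_val (u n) / 2 + r n.+1 / 2) -> r 0%N = ui_sum u.
Proof.
move=> r01 rE; apply: (@eq_dyadic _ _ 1) => n.
elim: n u r r01 rE => [|n IH] u r r01 rE.
  by have := r01 0%N; have := ui_delta_subproof u; rewrite expr0 ler_norml; lra.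
have := IH (stail u) (stail r) (fun n => r01 n.+1) (fun n => rE n.+1).
rewrite (ui_sumS u) (rE 0%N) exprSr invfM mulrA !ler_norml /stail; lra.
Qed.

Lemma binary_expansion r : 0 <= r <= 1 ->
  exists d : nat -> bool,
    r = ui_sum (fun n => if d n then mvone else mvzero : unit_interval R).
Proof.
(* The doubling map, with 1/2 sent to 0 and 1 fixed; the digit records which branch is taken. *)
move=> r01; pose double s : R := if 1 / 2 <= s then 2 * s - 1 else 2 * s.
pose t n := iter n double r.
exists (fun n => 1 / 2 <= t n); apply: (@ui_sum_unique _ t) => n.
  elim: n => [//|n]; rewrite /t iterS -/(t n) /double.
  by case: (leP (1 / 2) (t n)); lra.
rewrite /t iterS -/(t n) /double.
by case: (leP (1 / 2) (t n)) => _; rewrite ?ui_negE ui_zeroE; lra.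
Qed.

End real_lemmas.

(** * The map from a totally ordered quotient to the unit interval *)

Section prime_quotient.
Context {A : deltaAlgebraType} (R : realType) (J : set A).
Hypothesis (J_ideal : mvideal J) (J_proper : ~ J mvone).
Hypothesis J_total : forall x y, J (x ⊖ y) \/ J (y ⊖ x).
Implicit Types (x y z : A) (k l m n : nat).
Local Notation o := (@mvzero A).
Local Notation i := (@mvone A).
Local Notation dy k n := (mvmul k (mvdyadic n : A)).
Local Notation "x ≼ y" := (J (x ⊖ y)) (at level 70, no associativity).

Let J0 : J o. Proof. by case: J_ideal. Qed.
Let J_le x y : x ≤ y -> J y -> J x.
Proof. by case: J_ideal => _ + _; exact. Qed.

Let JD x y : J x -> J y -> J (x ⊕ y).
Proof. by case: J_ideal => _ _; exact. Qed.

Let leJ x y : x ≤ y -> x ≼ y. Proof. by rewrite /mvle => ->. Qed.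

Let leJ_trans y x z : x ≼ y -> y ≼ z -> x ≼ z.
Proof. by move=> xy yz; apply: J_le (JD xy yz); exact: mvminus_triangle. Qed.

Let leJ_plus x y u v : x ≼ y -> u ≼ v -> x ⊕ u ≼ y ⊕ v.
Proof. by move=> xy uv; apply: J_le (JD xy uv); exact: mvminus_plus. Qed.

(** If [l < k], then [J] would contain [dy (k - l) n], hence [mvdyadic n], of which [2 ^ n] copies
    make 1. *)
Let leJ_dyadic_refl n k l : (k <= 2 ^ n)%N -> dy k n ≼ dy l n -> (k <= l)%N.
Proof.
move=> kn; rewrite leqNgt => kl; apply/negP => lk.
move: kl; rewrite mvminusE (@mvmul_dyadicN _ _ _ (2 ^ n - k)) ?subnKC//.
rewrite -mvmulD (@mvmul_dyadicN _ _ _ (k - l)); last by lia.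
move=> Jkl; apply: J_proper; rewrite -(mvmul_dyadic1 n).
have Je : J (mvdyadic n).
  apply: J_le Jkl; rewrite -{1}[mvdyadic n]mvplusx0; apply: (@mvle_mul _ 1).
  by rewrite subn_gt0.
by elim: (2 ^ n)%N => [//|j IH]; apply: JD.
Qed.

Let leJ_dyadic m n k l :
  (k <= 2 ^ m)%N -> dy k m ≼ dy l n -> (k * 2 ^ n <= l * 2 ^ m)%N.
Proof.
move=> km; rewrite (mvmul_dyadic n m) (mvmul_dyadic m n) [(n + m)%N]addnC.
by apply: leJ_dyadic_refl; rewrite expnD leq_mul2r km orbT.
Qed.

(** The bound [k <= 2 ^ n] keeps the cut of 1 bounded: all larger multiples truncate to 1. *)
Definition dyadic_cut x : set R :=
  [set r | exists n k, [/\ (k <= 2 ^ n)%N, dy k n ≼ x & r = k%:R / 2 ^+ n]].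

Definition prime_state x : R := sup (dyadic_cut x).

Let cut0 x : dyadic_cut x 0.
Proof.
by exists 0%N, 0%N; split=> //; [exact/leJ/mvle0x|rewrite mul0r].
Qed.

Let cut_ub x n l : x ≼ dy l n -> ubound (dyadic_cut x) (l%:R / 2 ^+ n).
Proof.
move=> xl _ [m [k [km kx ->]]]; have := leJ_dyadic km (leJ_trans kx xl).
by rewrite ler_pdivlMr ?exprn_gt0// mulrAC ler_pdivrMr ?exprn_gt0//
  -!natrX -!natrM ler_nat.
Qed.

Let xle1 x : x ≼ dy 1 0.
Proof. by apply: leJ; rewrite /= mvplusx0; exact: mvlex1. Qed.

Lemma prime_state_lb x n k :
  (k <= 2 ^ n)%N -> dy k n ≼ x -> k%:R / 2 ^+ n <= prime_state x.
Proof.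
move=> kn kx; apply: ub_le_sup; last by exists n, k.
by exists (1%:R / 2 ^+ 0); exact: cut_ub.
Qed.

Lemma prime_state_ub x n l : x ≼ dy l n -> prime_state x <= l%:R / 2 ^+ n.
Proof.
by move=> xl; apply: ge_sup; [exists 0; exact: cut0|exact: cut_ub].
Qed.

Lemma prime_state01 x : 0 <= prime_state x <= 1.
Proof.
apply/andP; split.
  by have := @prime_state_lb x 0 0 isT (leJ (mvle0x x)); rewrite mul0r.
by have := prime_state_ub (xle1 x); rewrite expr0 divr1.
Qed.

(** Take the least [k] satisfying the upper bound; its minimality and the totality of the quotient
    give the lower bound. *)
Lemma prime_dyadic_approx n x :
  exists2 k, (k < 2 ^ n)%N & dy k n ≼ x /\ x ≼ dy k.+1 n.
Proof.
have : exists k, `[< x ≼ dy k.+1 n >].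
  exists (2 ^ n).-1; apply/asboolP; rewrite prednK ?expn_gt0// mvmul_dyadic1.
  exact/leJ/mvlex1.
move=> /ex_minnP[k /asboolP xk kmin]; exists k; last split=> //.
  rewrite -[X in (_ < X)%N]prednK ?expn_gt0// ltnS; apply: kmin.
  apply/asboolP; rewrite prednK ?expn_gt0// mvmul_dyadic1.
  exact/leJ/mvlex1.
case: k kmin {xk} => [|k] kmin; first exact/leJ/mvle0x.
have [//|xk] := J_total (dy k.+1 n) x.
by have := kmin k; rewrite ltnn => H; have := H (asboolT xk).
Qed.

Lemma prime_state0 : prime_state o = 0.
Proof.
apply/eqP; rewrite eq_le; have /andP[-> _] := prime_state01 o; rewrite andbT.
by have := @prime_state_ub o 0 0 (leJ (mvle_refl _)); rewrite mul0r.
Qed.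

(** Negation mirrors the dyadic interval of length [2 ^- n] around [x], and both sides lie in the
    mirror image. *)
Lemma prime_stateN x : prime_state (¬ x) = 1 - prime_state x.
Proof.
apply: (@eq_dyadic _ _ _ 1) => n.
have [k kn [kx xk]] := prime_dyadic_approx n x.
have := @prime_state_lb (¬ x) n (2 ^ n - k.+1)%N (leq_subr _ _).
rewrite -(@mvmul_dyadicN _ n k.+1) ?subnKC// mvminus_neg => /(_ xk).
have := @prime_state_ub (¬ x) n (2 ^ n - k)%N.
rewrite -(@mvmul_dyadicN _ n k) ?(subnKC (ltnW kn))// mvminus_neg => /(_ kx).
have := prime_state_lb (ltnW kn) kx; have := prime_state_ub xk.
rewrite (natrB _ kn) (natrB _ (ltnW kn)) natrX ler_norml -natr1.
have : (0 : R) < 2 ^+ n by rewrite exprn_gt0.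
move: (prime_state x) (prime_state (¬ x)) => a b e0.
rewrite !mulrBl !mulrDl divff ?gt_eqF//.
by move: (k%:R / _) (1 / _) => c d; lra.
Qed.

Lemma prime_stateD x y :
  prime_state (x ⊕ y) = Num.min (prime_state x + prime_state y) 1.
Proof.
apply: (@eq_dyadic _ _ _ 2) => n.
have [k kn [kx xk]] := prime_dyadic_approx n x.
have [l ln [ly yl]] := prime_dyadic_approx n y.
have klxy := leJ_plus kx ly; rewrite -mvmulD in klxy.
have xykl := leJ_plus xk yl; rewrite -mvmulD in xykl.
have := prime_state_ub xykl.
(* [prime_state_lb] needs a numerator of at most [2 ^ n]; this cap becomes the truncation at 1. *)
have : dy (minn (k + l) (2 ^ n)) n ≼ x ⊕ y.
  by apply: leJ_trans klxy; apply: leJ; apply: mvle_mul; exact: geq_minl.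
move/(prime_state_lb (geq_minr _ _)).
have := prime_state_lb (ltnW kn) kx; have := prime_state_ub xk.
have := prime_state_lb (ltnW ln) ly; have := prime_state_ub yl.
have /andP[_] := prime_state01 (x ⊕ y).
have e0 : (0 : R) < 2 ^+ n by rewrite exprn_gt0.
rewrite natr_min natrX minr_pMl ?invr_ge0 ?(ltW e0)// divff ?gt_eqF//.
rewrite !natrD -!natr1 ler_norml !mulrDl.
move: (k%:R / _) (l%:R / _) (1 / _) => a b c.
by case: (leP (a + b) 1); case: (leP (prime_state x + prime_state y) 1); lra.
Qed.

End prime_quotient.

(** * Homomorphisms from a δ-algebra to the unit interval *)

Section delta_homs.
Context {R : realType} {A : deltaAlgebraType}.
Local Notation I := (unit_interval R).
Implicit Types (x y : A).
Local Notation half := (half_of (@delta A)).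

Section mv_hom.
Context (f : A -> I) (f0 : f mvzero = mvzero).
Hypotheses (fD : {morph f : x y / x ⊕ y}) (fN : {morph f : x / ¬ x}).

Let f_le x y : x ≤ y -> ui_val (f x) <= ui_val (f y).
Proof.
move=> xy; have := congr1 (fun z => ui_val (f z)) xy.
rewrite mvminusE !(fN, fD) f0 -mvminusE ui_minusE ui_zeroE => /max_idPr.
by rewrite subr_le0.
Qed.

(** [half mvone] is its own negation, so it goes to 1/2. By monotonicity [half x] goes to at most
    1/2, so doubling its image is not truncated. *)
Lemma mv_hom_half x : ui_val (f (half x)) = ui_val (f x) / 2.
Proof.
have half1 : ui_val (f (half mvone)) = 1 / 2.
  have := congr1 (fun z => ui_val (f z)) (@half_one A).
  by rewrite /= fN ui_negE; lra.
have := f_le (half_le (mvlex1 x)); rewrite half1.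
have := congr1 (fun z => ui_val (f z)) (half_plus x).
by rewrite fD ui_plusE; case: (leP (_ + _) 1); lra.
Qed.

Lemma mv_hom_delta (u : nat -> A) : f (delta u) = delta (fun n => f (u n)).
Proof.
pose tl n := iter n (@stail A) u.
have tlE n k : tl n k = u (n + k)%N.
  by rewrite /tl; elim: n k => [//|n IH] k; rewrite iterS /stail IH addnS.
apply: ui_valP; rewrite -[RHS]/(ui_sum (fun n => f (u n))).
apply: (@ui_sum_unique _ _ (fun n => ui_val (f (delta (tl n))))) => n.
  by rewrite ui_ge0 ui_le1.
have := congr1 (fun z => ui_val (f z)) (deltaE (tl n)).
rewrite fD ui_plusE !mv_hom_half tlE addn0 -[stail (tl n)]/(tl n.+1) => ->.
have ? := ui_le1 (f (u n)); have ? := ui_le1 (f (delta (tl n.+1))).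
by case: (leP (_ + _) 1); lra.
Qed.

End mv_hom.

Lemma delta_hom_separates (a : A) :
  a <> mvzero -> exists h : deltaHom A I, h a <> mvzero.
Proof.
move=> a0; have [n an] : exists n, ~ a ≤ mvdyadic n.
  apply: contrapT => H; apply/a0/delta_archimedean => n.
  by apply: contrapT => an; apply: H; exists n.
have [J [JI Jan Jtot]] := mvideal_prime_avoiding an.
have [_ Jle _] := JI.
have J1 : ~ J mvone by move=> J1; apply: Jan; apply: Jle J1; exact: mvlex1.
pose f x : I := ui_mk (prime_state01 R JI J1 x).
have f0 : f mvzero = mvzero by apply: ui_valP; exact: prime_state0.
have fD : {morph f : x y / x ⊕ y}.
  by move=> x y; apply: ui_valP; exact: prime_stateD.
have fN : {morph f : x / ¬ x}.
  by move=> x; apply: ui_valP; exact: prime_stateN.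
exists (DeltaHom f0 fD fN (mv_hom_delta f0 fD fN)) => /= fa.
(* As [J] avoids [a ⊖ mvdyadic n], totality puts [mvdyadic n] below [a] modulo [J], so [f a] is at
   least [2 ^- n]. *)
have [//|na] := Jtot a (mvdyadic n).
have := @prime_state_lb _ R _ JI J1 a n 1.
rewrite expn_gt0 /= mvplusx0 => /(_ isT na).
have -> : prime_state R J a = ui_val (f a) by [].
by rewrite fa ui_zeroE leNgt divr_gt0 ?exprn_gt0.
Qed.

Lemma delta_homE (h : deltaHom A I) (u : nat -> A) :
  ui_val (h (delta u)) = ui_sum (fun n => h (u n)).
Proof. by rewrite delta_fun_delta. Qed.

Lemma delta_hom_half (h : deltaHom A I) x :
  ui_val (h (half x)) = ui_val (h x) / 2.
Proof.
exact: (mv_hom_half (delta_fun0 h) (@delta_funD _ _ h) (@delta_funN _ _ h)).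
Qed.

Lemma delta_hom_minus (h : deltaHom A I) x y : h (x ⊖ y) = h x ⊖ h y.
Proof. by rewrite !mvminusE !(delta_funN, delta_funD). Qed.

Lemma delta_hom_mul (h : deltaHom A I) n x :
  ui_val (h (mvmul n x)) = Num.min (ui_val (h x) *+ n) 1.
Proof.
elim: n => [|n IH] /=.
  by rewrite delta_fun0 ui_zeroE mulr0n (min_idPl ler01).
rewrite delta_funD ui_plusE IH mulrS; have ? := ui_ge0 (h x).
by case: (leP (_ *+ n) 1) => ? //; rewrite !min_r//; lra.
Qed.

(** Homomorphisms preserve 0, 1 and [delta], so [delta] of the binary digits of [r] works for all of
    them at once. *)
Lemma delta_constant (r : R) : 0 <= r <= 1 ->
  exists c : A, forall h : deltaHom A I, ui_val (h c) = r.
Proof.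
move=> /binary_expansion[d ->].
exists (delta (fun n => if d n then mvone else mvzero)) => h.
rewrite delta_homE; congr ui_sum; apply/funext => n.
by case: (d n); rewrite ?delta_funN delta_fun0.
Qed.

End delta_homs.

(** * Stone-Weierstrass *)

(** Otherwise the sets whose complement satisfies [P] would form a proper filter, and [P] near one
    of its cluster points is contradictory. This replaces the choice of finite subcovers below. *)
Lemma compact_local_global (T : topologicalType) (P : set (set T)) :
  compact [set: T] -> P set0 ->
  (forall U V, U `<=` V -> P V -> P U) ->
  (forall U V, P U -> P V -> P (U `|` V)) ->
  (forall x : T, exists2 U, nbhs x U & P U) -> P setT.
Proof.
move=> cT P0 Psub PU Ploc; apply: contrapT => PT.
pose F : set_system T := fun U => P (~` U).
have FF : ProperFilter F.
  split; first by rewrite /F setC0.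
  split; first by rewrite /F setCT.
  - by move=> U V FU FV; rewrite /F setCI; exact: PU.
  - by move=> U V UV; apply: Psub; exact: subsetC.
have [|x [_ clx]] := cT F FF; first by rewrite /F setCT.
have [U xU PU'] := Ploc x.
have FU : F (~` U) by rewrite /F setCK.
by have [y []] := clx _ _ FU xU.
Qed.

Section unit_interval_extra.
Context {R : realType}.
Local Notation I := (unit_interval R).

Lemma ui_val_continuous (T : topologicalType) (f : T -> I) :
  continuous f -> forall t, ui_val (f w) @[w --> t] --> ui_val (f t).
Proof. by move=> cf t; have /ui_val_cvg := cf t. Qed.

Lemma ui_near_lt (T : topologicalType) (f g : T -> I) (e : R) (t : T) :
  continuous f -> continuous g -> ui_val (f t) < ui_val (g t) + e ->
  \forall w \near t, ui_val (f w) < ui_val (g w) + e.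
Proof.
move=> cf cg fg.
have ft := ui_val_continuous cf; have gt := ui_val_continuous cg.
have := cvgr_lt _ (cvgB (ft t) (gt t)) e.
by rewrite ltrBlDl => /(_ _ _ fg); apply: filterS => w; rewrite ltrBlDl.
Qed.

Lemma natmul_ge1 (r : R) : 0 < r -> exists n, 1 <= r *+ n.
Proof.
move=> r0; exists (Num.bound r^-1).
have r1 : 0 <= r^-1 by rewrite invr_ge0 ltW.
by rewrite -mulr_natl -ler_pdivrMr// div1r ltW// archi_boundP.
Qed.

Lemma delta_hom_sup (A : deltaAlgebraType) (h : deltaHom A I) (x y : A) :
  ui_val (h ((x ⊖ y) ⊕ y)) = Num.max (ui_val (h x)) (ui_val (h y)).
Proof.
rewrite delta_funD delta_hom_minus ui_plusE ui_minusE.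
have := ui_le1 (h x); have := ui_le1 (h y).
move: (ui_val (h x)) (ui_val (h y)) => a b ? ?.
case: (leP (a - b) 0) => ?; case: (leP a b) => ?; rewrite min_l; lra.
Qed.

Lemma delta_hom_inf (A : deltaAlgebraType) (h : deltaHom A I) (x y : A) :
  ui_val (h (x ⊖ (x ⊖ y))) = Num.min (ui_val (h x)) (ui_val (h y)).
Proof.
rewrite !delta_hom_minus !ui_minusE.
have := ui_ge0 (h x); have := ui_ge0 (h y).
move: (ui_val (h x)) (ui_val (h y)) => a b ? ?.
by case: (leP (a - b) 0) => ?; case: (leP a b) => ?; rewrite max_l; lra.
Qed.

End unit_interval_extra.

(** * Evaluation homomorphisms and injectivity of the representation *)

Section evaluation.
Context {R : realType}.
Local Notation I := (unit_interval R).

Section point.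
Context {X : compactHausdorff} (x : X).

Definition c01_eval (f : cont01 R X) : I := c01_fun f x.

Definition c01_eval_hom : deltaHom (cont01 R X) I :=
  @DeltaHom (cont01 R X) I c01_eval
    erefl (fun _ _ => erefl) (fun _ => erefl) (fun _ => erefl).

End point.

Context (A : deltaAlgebraType).

Definition dhom_hat (a : A) : cont01 R (dhom_space R A) :=
  @c01_mk R (dhom_space R A) _ (@dhom_eval_continuous R A a).

Lemma dhom_hat0 : dhom_hat mvzero = mvzero.
Proof. by apply: c01P => h; exact: delta_fun0. Qed.

Lemma dhom_hatD : {morph dhom_hat : a b / a ⊕ b}.
Proof. by move=> a b; apply: c01P => h; exact: delta_funD. Qed.

Lemma dhom_hatN : {morph dhom_hat : a / ¬ a}.
Proof. by move=> a; apply: c01P => h; exact: delta_funN. Qed.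

Lemma dhom_hat_delta (u : nat -> A) :
  dhom_hat (delta u) = delta (fun n => dhom_hat (u n)).
Proof. by apply: c01P => h; exact: delta_fun_delta. Qed.

Definition dhom_hat_hom : deltaHom A (cont01 R (dhom_space R A)) :=
  DeltaHom dhom_hat0 dhom_hatD dhom_hatN dhom_hat_delta.

Lemma dhom_hat_inj : injective dhom_hat.
Proof.
have le a b : dhom_hat a = dhom_hat b -> a ≤ b.
  move=> ab; apply: contrapT => /(@delta_hom_separates R)[h]; apply.
  have := congr1 (fun f => c01_fun f (h : dhom_space R A)) ab => /= hab.
  have {}hab : h a = h b by [].
  by rewrite delta_hom_minus hab; exact: mvle_refl.
by move=> a b ab; apply: mvle_anti; apply: le.
Qed.

End evaluation.

Section stone_weierstrass.
Context {R : realType} (A : deltaAlgebraType).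
Local Notation I := (unit_interval R).
Local Notation S := (dhom_space R A).
Implicit Types (a b c : A) (s t w : S).

Let ev a (s : S) : R := ui_val (dhom_eval a s).

Let ev_sup a b s : ev ((a ⊖ b) ⊕ b) s = Num.max (ev a s) (ev b s).
Proof. exact: delta_hom_sup. Qed.

Let ev_inf a b s : ev (a ⊖ (a ⊖ b)) s = Num.min (ev a s) (ev b s).
Proof. exact: delta_hom_inf. Qed.

Let ev_minus a b s : ev (a ⊖ b) s = Num.max (ev a s - ev b s) 0.
Proof. by rewrite -ui_minusE /ev; congr ui_val; exact: delta_hom_minus. Qed.

Let ev_plus a b s : ev (a ⊕ b) s = Num.min (ev a s + ev b s) 1.
Proof. by rewrite -ui_plusE /ev; congr ui_val; exact: delta_funD. Qed.

Let ev_neg a s : ev (¬ a) s = 1 - ev a s.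
Proof. by rewrite -ui_negE /ev; congr ui_val; exact: delta_funN. Qed.

Let ev_cst (r : R) : 0 <= r <= 1 -> exists c, forall s, ev c s = r.
Proof. by move=> /(@delta_constant R A)[c H]; exists c => s; exact: H. Qed.

Let ev01 a s : 0 <= ev a s <= 1.
Proof. by rewrite /ev ui_ge0 ui_le1. Qed.

(** For [a] smaller at [s] than at [t], subtract its value at [s] and multiply until the value at
    [t] truncates to 1; in the opposite case use [¬ a]. *)
Lemma dhom_separating s t : s <> t ->
  exists c : A, ui_val (dhom_eval c s) = 0 /\ ui_val (dhom_eval c t) = 1.
Proof.
have lt_case a : ev a s < ev a t -> exists c, ev c s = 0 /\ ev c t = 1.
  move=> ast; have [r rE] := ev_cst (ev01 a s).
  have [n nP] : exists n, 1 <= (ev a t - ev a s) *+ n.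
    by apply: natmul_ge1; rewrite subr_gt0.
  have mulE w : ev (mvmul n (a ⊖ r)) w = Num.min (ev (a ⊖ r) w *+ n) 1.
    exact: delta_hom_mul.
  exists (mvmul n (a ⊖ r)); rewrite !mulE !ev_minus !rE subrr maxxx mul0rn.
  by rewrite max_l ?subr_ge0 1?ltW// min_l// min_r.
move=> st; have [a ast] : exists a, ev a s <> ev a t.
  apply: contrapT => H; apply/st/dhomP => a; apply: ui_valP.
  by apply: contrapT => ast; apply: H; exists a.
have [/lt_case//|ats|//] := ltgtP (ev a s) (ev a t).
by apply: (lt_case (¬ a)); rewrite !ev_neg; lra.
Qed.

Section approximation.
Context (g : S -> I) (g_cts : continuous g).

Let interpolate s t :
  exists b, ev b s = ui_val (g s) /\ ev b t = ui_val (g t).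
Proof.
have g01 w : 0 <= ui_val (g w) <= 1 by rewrite ui_ge0 ui_le1.
have [p pE] := ev_cst (g01 s); have [q qE] := ev_cst (g01 t).
have [<-|/dhom_separating[c [cs ct]]] := pselect (s = t); first by exists p.
(* The sum of the meets of [p] with [¬ c] and of [q] with [c]: only the first survives at [s], only
   the second at [t]. *)
exists ((p ⊖ (p ⊖ ¬ c)) ⊕ (q ⊖ (q ⊖ c))).
rewrite !ev_plus !ev_inf !ev_neg !pE !qE /ev cs ct subr0 subrr.
have /andP[s0 s1] := g01 s; have /andP[t0 t1] := g01 t.
by split; rewrite !(min_l s1, min_l t1, min_r s0, min_r t0) ?addr0 ?add0r
  ?(min_l s1) ?(min_l t1).
Qed.

(** The interpolant for [s] and [t] satisfies the bound near [t]; finite meets of such interpolants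
    keep the value at [s]. *)
Let upper s : exists b, ev b s = ui_val (g s) /\
  forall w, ev b w < ui_val (g w) + 1 / 4.
Proof.
pose P (U : set S) := exists b, ev b s = ui_val (g s) /\
  forall w, U w -> ev b w < ui_val (g w) + 1 / 4.
suff [b [bs bg]] : P setT by exists b; split=> // w; exact: bg.
apply: compact_local_global.
- exact: dhom_compact.
- by have [b [bs _]] := interpolate s s; exists b; split=> // w [].
- by move=> U V UV [b [bs bV]]; exists b; split=> // w /UV; exact: bV.
- move=> U V [b [bs bU]] [c [cs cV]]; exists (b ⊖ (b ⊖ c)).
  split; first by rewrite ev_inf bs cs minxx.
  by move=> w [/bU bw|/cV cw]; rewrite ev_inf gt_min ?bw ?cw ?orbT.
- move=> t; have [b [bs bt]] := interpolate s t.
  exists [set w | ev b w < ui_val (g w) + 1 / 4]; last by exists b; split.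
  apply: (@ui_near_lt R S (dhom_eval b) g) => //.
    exact: dhom_eval_continuous.
  by rewrite -/(ev b t) bt; lra.
Qed.

(** Dually, finite joins of the functions from [upper] over varying [s]. *)
Lemma dhom_approximation : exists b : A, forall w,
  `|ui_val (dhom_eval b w) - ui_val (g w)| < 1 / 4.
Proof.
pose P (U : set S) := exists b, (forall w, ev b w < ui_val (g w) + 1 / 4) /\
  forall w, U w -> ui_val (g w) < ev b w + 1 / 4.
suff [b [bg gb]] : P setT.
  exists b => w; rewrite -/(ev b w); have := gb w Logic.I; have := bg w.
  by rewrite ltr_norml; lra.
apply: compact_local_global.
- exact: dhom_compact.
- have [z zE] : exists z, forall w, ev z w = 0.
    by apply: ev_cst; rewrite lexx ler01.
  by exists z; split=> // w; rewrite zE; have := ui_ge0 (g w); lra.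
- by move=> U V UV [b [bs bV]]; exists b; split=> // w /UV; exact: bV.
- move=> U V [b [bg bU]] [c [cg cV]]; exists ((b ⊖ c) ⊕ c); split=> w.
    by rewrite ev_sup gt_max bg cg.
  rewrite ev_sup -ltrBlDr lt_max !ltrBlDr.
  by move=> [/bU ->|/cV ->]; rewrite ?orbT.
- move=> s; have [b [bs bg]] := upper s.
  exists [set w | ui_val (g w) < ev b w + 1 / 4]; last by exists b; split.
  apply: (@ui_near_lt R S g (dhom_eval b)) => //.
    exact: dhom_eval_continuous.
  by rewrite -/(ev b s) bs; lra.
Qed.

(* One step of a binary expansion of [g] with digits in [A]. *)
Lemma dhom_digit : exists a : A, forall w,
  2 * ui_val (g w) - 1 <= ui_val (dhom_eval a w) <= 2 * ui_val (g w).
Proof.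
have [b bP] := dhom_approximation.
have [q qE] : exists q, forall w, ev q w = 1 / 4 by apply: ev_cst; lra.
(* [b - 1/4] lies between [g - 1/2] and [g], so its double lies in the required range; truncating to
   [0, 1] respects this because [2 g >= 0] and [2 g - 1 <= 1]. *)
exists ((b ⊖ q) ⊕ (b ⊖ q)) => w; have := bP w.
rewrite -/(ev b w) -/(ev _ w) ev_plus ev_minus qE ltr_norml.
have := ui_le1 (g w); have := ui_ge0 (g w).
by case: (leP (ev b w - 1 / 4) 0) => ? ? ?; case: (leP (_ + _) 1) => ?; lra.
Qed.

End approximation.

Lemma dhom_hat_surj (g : cont01 R S) : exists a : A, dhom_hat a = g.
Proof.
pose digit (f : cont01 R S) : A := projT1 (cid (dhom_digit (@c01_cts _ _ f))).
(* This is [2 f - a] for the digit [a] of [f]; the two bounds on the digit keep the difference and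
   the sum untruncated. *)
pose rest (f : cont01 R S) : cont01 R S :=
  let r := f ⊖ half_of delta (dhom_hat (digit f)) in r ⊕ r.
have restE f w : ui_val (c01_fun f w) =
    ui_val (dhom_eval (digit f) w) / 2 + ui_val (c01_fun (rest f) w) / 2.
  have -> : c01_fun (rest f) w = c01_eval_hom w (rest f) by [].
  rewrite /rest delta_funD delta_hom_minus ui_plusE ui_minusE delta_hom_half.
  have := projT2 (cid (dhom_digit (@c01_cts _ _ f))) w.
  rewrite -/(digit f) -[c01_eval_hom w (dhom_hat _)]/(dhom_eval (digit f) w).
  rewrite -[c01_eval_hom w f]/(c01_fun f w) => /andP[? ?].
  rewrite max_l ?min_l; lra.
exists (delta (fun n => digit (iter n rest g))).
apply: c01P => w; apply: ui_valP.
transitivity (ui_sum (fun n => dhom_eval (digit (iter n rest g)) w)).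
  exact: delta_homE.
apply/esym/(@ui_sum_unique _ _ (fun n => ui_val (c01_fun (iter n rest g) w))).
  by move=> n; rewrite ui_ge0 ui_le1.
by move=> n; rewrite iterS; exact: restE.
Qed.

End stone_weierstrass.

(** * Duality *)

Section duality.
Context (R : realType).
Local Notation I := (unit_interval R).

Lemma deltaHom_isomorphism (A B : deltaAlgebraType) (f : deltaHom A B) :
  injective f -> (forall b, exists a, f a = b) -> @isomorphism Delta A B f.
Proof.
move=> finj fsurj; pose g (b : B) : A := projT1 (cid (fsurj b)).
have gK b : f (g b) = b := projT2 (cid (fsurj b)).
have g0 : g mvzero = mvzero by apply: finj; rewrite gK delta_fun0.
have gD : {morph g : a b / a ⊕ b}.
  by move=> a b; apply: finj; rewrite delta_funD !gK.
have gN : {morph g : a / ¬ a}.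
  by move=> a; apply: finj; rewrite delta_funN !gK.
have gd u : g (delta u) = delta (fun n => g (u n)).
  apply: finj; rewrite delta_fun_delta gK; congr delta.
  by apply/funext => n; rewrite gK.
exists (DeltaHom g0 gD gN gd); split; apply: deltaHomP => x /=; last exact: gK.
by apply: finj; exact: gK.
Qed.

(** The map is closed, since closed subsets of [X] are compact and compact subsets of [Y] are
    closed. *)
Lemma compactHausdorff_isomorphism (X Y : compactHausdorff)
    (f : continuousType X Y) :
  injective f -> (forall y, exists x, f x = y) -> @isomorphism KH X Y f.
Proof.
move=> finj fsurj; pose g (y : Y) : X := projT1 (cid (fsurj y)).
have gK y : f (g y) = y := projT2 (cid (fsurj y)).
have g_cts : continuous g.
  apply/continuous_closedP => C clC.
  have -> : g @^-1` C = f @` C.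
    apply/seteqP; split=> y /=; first by exists (g y).
    by move=> [x Cx <-]; rewrite /preimage /= (_ : g _ = x)//; exact: finj.
  apply: compact_closed; first exact: ch_hausdorff.
  apply: continuous_compact.
    by apply: continuous_subspaceT; exact: cts_fun.
  exact: subclosed_compact clC (@ch_compact X) _.
exists (mkcts g_cts : continuousType Y X).
by split; apply/continuousEP => x /=; [apply: finj|]; exact: gK.
Qed.

(** * Points of a compact Hausdorff space as homomorphisms *)

Section points.
Context (X : compactHausdorff).
Local Notation SX := (dhom_space R (cont01 R X)).

Lemma c01_eval_continuous :
  continuous (fun x : X => c01_eval_hom x : dhom01 R (cont01 R X)).
Proof.
move=> x; have FF : Filter ((fun y : X => c01_eval_hom y : SX) @ nbhs x).
  by apply: fmap_filter; exact: nbhs_filter.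
apply: (dhom_cvg _ FF).2 => f.
exact: (@c01_cts R X f x).
Qed.

Definition c01_point : ch_hom X SX :=
  (mkcts c01_eval_continuous : continuousType X (dhom01 R (cont01 R X))).

Lemma c01_point_inj : injective (fun x : X => c01_eval_hom x : SX).
Proof.
move=> x y xy; apply: contrapT => nxy.
have [hX cX] := (@ch_hausdorff X, @ch_compact X).
have acc := hausdorff_accessible hX.
have cl1 := accessible_closed_set1 acc.
have := @normal_completely_regular R _ (compact_normal hX cX) acc x [set y].
move=> /(_ (cl1 y) nxy)/(@uniform_separatorP _ R)[f [fc f01 fx fy]].
have f01' z : 0 <= f z <= 1.
  by have := f01 (f z) (ex_intro2 _ _ z Logic.I erefl); rewrite /= in_itv.
pose F (z : X) : I := ui_mk (f01' z).
have Fc : continuous F by move=> z; apply/ui_val_cvg; exact: fc.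
pose ev (h : dhom01 R (cont01 R X)) := ui_val (dhom_eval (c01_mk Fc) h).
have := congr1 ev xy.
rewrite -[LHS]/(f x) -[RHS]/(f y) (fx (f x)); last by exists x.
rewrite (fy (f y)); last by exists y.
by move/eqP; rewrite eq_sym oner_eq0.
Qed.

(* If [h] is not an evaluation, then each point has a neighbourhood on which
   some [f] with [h f = 0] equals [1]; by compactness [h] would kill [1]. *)
Lemma c01_point_surj (h : deltaHom (cont01 R X) I) :
  exists x : X, c01_eval_hom x = h.
Proof.
apply: contrapT => nh.
pose P (U : set X) := exists f : cont01 R X,
  h f = mvzero /\ forall x, U x -> ui_val (c01_fun f x) = 1.
suff [f [hf f1]] : P setT.
  have fE : f = mvone.
    apply: c01P => x; apply: ui_valP; rewrite f1//.
    by rewrite -[RHS]/(ui_val (mvneg (mvzero : I))) ui_negE ui_zeroE subr0.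
  have := congr1 ui_val hf.
  by rewrite fE delta_funN delta_fun0 ui_negE ui_zeroE; lra.
apply: compact_local_global; first exact: ch_compact.
- by exists mvzero; split; [exact: delta_fun0|move=> x []].
- by move=> U V UV [f [hf fV]]; exists f; split=> // x /UV; exact: fV.
- move=> U V [f [hf fU]] [k [hk kV]]; exists (f ⊕ k); split.
    by rewrite delta_funD hf hk mvplusx0.
  move=> x UVx; rewrite -[c01_fun _ x]/(c01_fun f x ⊕ c01_fun k x) ui_plusE.
  have := ui_ge0 (c01_fun f x); have := ui_ge0 (c01_fun k x).
  by case: UVx => [/fU ->|/kV ->] ? ?; rewrite min_r//; lra.
- move=> x; have [f hfx] : exists f, h f <> c01_fun f x.
    apply: contrapT => H; apply: nh; exists x; apply: deltaHomP => f.
    by apply: contrapT => hf; apply: H; exists f => /esym.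
  have hf01 : 0 <= ui_val (h f) <= 1 by rewrite ui_ge0 ui_le1.
  have [r rE] := @delta_constant R (cont01 R X) _ hf01.
  (* The function [|f - h f|]: it is killed by [h] and positive at [x]. *)
  pose k : cont01 R X := mvdist f r.
  have kE (l : deltaHom (cont01 R X) I) :
      ui_val (l k) = `|ui_val (l f) - ui_val (h f)|.
    rewrite /k /mvdist delta_funD !delta_hom_minus -/(mvdist _ _).
    by rewrite ui_distE rE.
  have kx : 0 < ui_val (c01_fun k x).
    rewrite -[c01_fun k x]/(c01_eval_hom x k) kE normr_gt0 subr_eq0.
    by apply/eqP => /ui_valP/esym.
  (* Chosen for half the value at [x], so that the multiple of [k] is 1 wherever [k] exceeds that
     half. *)
  have [n n1] := natmul_ge1 (divr_gt0 kx (ltr0Sn R 1)).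
  exists [set y | ui_val (c01_fun k x) / 2 < ui_val (c01_fun k y)].
    by apply: (cvgr_gt _ (@ui_val_continuous R X _ (@c01_cts R X k) x)); lra.
  exists (mvmul n k); split.
    apply: ui_valP; rewrite delta_hom_mul kE subrr normr0 mul0rn.
    by rewrite (min_idPl ler01).
  move=> y /= ky; rewrite -[c01_fun _ y]/(c01_eval_hom y (mvmul n k)).
  rewrite delta_hom_mul min_r//; apply: le_trans n1 _.
  by rewrite lerMn2r; apply/orP; right; exact: ltW.
Qed.

End points.

End duality.

Theorem theorem8p2 (R : realType) :
  dual_equivalence (cont_functor R) (dhom_functor R).
Proof.
split.
- exists (fun X : KH => c01_point R X); split=> [X Y f|X].
    (* Both composites send [x] and [g] to the value of [g] at [f x]. *)
    by apply/continuousEP => x; apply: deltaHomP => g.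
  apply: compactHausdorff_isomorphism; first exact: c01_point_inj.
  exact: c01_point_surj.
- exists (fun A : Delta => dhom_hat_hom A); split=> [A B f|A].
    by apply: deltaHomP => a; apply: c01P => h.
  by apply: deltaHom_isomorphism; [exact: dhom_hat_inj|exact: dhom_hat_surj].
Qed.
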